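(* Let $A\in\mathcal{B}(\mathcal{H})$ be a selfadjoint operator on a real or complex Hilbert space $\mathcal{H}$ and let $\mathcal{F}$ and $\mathcal{G}$ be nontrivial subspaces of $\mathcal{H}$. Let in addition $\mathcal{F}$ be an $A$-invariant subspace of $\mathcal{H}$ corresponding to the top (or bottom) part of the spectrum of $A$. Then $$\mathrm{dist}\big(\Sigma(A|_{\mathcal{F}}),\ \Sigma((P_{\mathcal{G}}A)|_{\mathcal{G}})\big)\le\big(\max\{\Sigma(A)\}-\min\{\Sigma(A)\}\big)\,\mathrm{gap}^2(\mathcal{F},\mathcal{G}).$$
   Context: A subspace means a closed linear manifold; nontrivial means different from $\{0\}$. $\mathcal{B}(\mathcal{H})$ is the space of bounded linear operators on $\mathcal{H}$; $P_{\mathcal{G}}$ is the orthogonal projector onto $\mathcal{G}$; $\Sigma$ denotes the spectrum; $(P_{\mathcal{G}}A)|_{\mathcal{G}}$ is regarded as an operator $\mathcal{G}\to\mathcal{G}$. If $\mathcal{F}$ is $A$-invariant, so is $\mathcal{F}^\perp$; $\mathcal{F}$ corresponds to the top part of the spectrum of $A$ if $\max\{\Sigma(A|_{\mathcal{F}^\perp})\}\le\min\{\Sigma(A|_{\mathcal{F}})\}$, and to the bottom part if the same holds with $A$ replaced by $-A$ (the condition being vacuous if $\mathcal{F}^\perp=\{0\}$). For bounded real sets $S_1,S_2$, $\mathrm{dist}(S_1,S_2)=\max\{\sup_{u\in S_1}\mathrm{dist}(u,S_2),\sup_{v\in S_2}\mathrm{dist}(v,S_1)\}$ is the Hausdorff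 distance, where $\mathrm{dist}(u,S)=\inf_{v\in S}|u-v|$. The gap is $\mathrm{gap}(\mathcal{F},\mathcal{G})=\|P_{\mathcal{F}}-P_{\mathcal{G}}\|$ (operator norm). *)

(* Defs.v *)
From mathcomp Require Import all_boot all_order all_algebra.
From mathcomp Require Import sesquilinear.
From mathcomp Require Import all_classical all_reals all_analysis.
From mathcomp Require Import complex.
Import Order.TTheory GRing.Theory Num.Theory.
Import numFieldNormedType.Exports.

Set Implicit Arguments.
Unset Strict Implicit.
Unset Printing Implicit Defensive.

Local Open Scope classical_set_scope.
Local Open Scope ring_scope.

Variant scalar_kind := RealScalars | ComplexScalars.

Definition scalar_field (R : realType) (k : scalar_kind) : numFieldType :=
  match k with
  | RealScalars => R
  | ComplexScalars => R[i]
  end.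

Definition conj_scalar (R : realType) (k : scalar_kind) :
    scalar_field R k -> scalar_field R k :=
  match k with
  | RealScalars => fun x => x
  | ComplexScalars => fun z => Num.conj (z : R[i])
  end.

Definition of_real (R : realType) (k : scalar_kind) : R -> scalar_field R k :=
  match k with
  | RealScalars => fun r => r
  | ComplexScalars => fun r => (r%:C)%C
  end.

Definition re_scalar (R : realType) (k : scalar_kind) : scalar_field R k -> R :=
  match k with
  | RealScalars => fun x => x
  | ComplexScalars => fun z => complex.Re z
  end.

Arguments conj_scalar {R k} _.
Arguments of_real {R k} _.
Arguments re_scalar {R k} _.

(* A norm [`|x|] over [scalar_field R k] is an element of [scalar_field R k], real and
   nonnegative; this is the same number as an element of [R]. *)
Definition rnorm (R : realType) (k : scalar_kind)
    (V : normedModType (scalar_field R k)) (x : V) : R := re_scalar `|x|.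

Definition rabs (R : realType) (k : scalar_kind) (u : scalar_field R k) : R :=
  re_scalar `|u|.

Section ScalarSets.
Variables (R : realType) (k : scalar_kind).
Local Notation K := (scalar_field R k).
Implicit Types (S : set K) (u : K).

(* The order of [R[i]] only compares numbers with the same imaginary part, so
   on sets of real scalars the two definitions below are the usual greatest and
   least elements; they are 0 when there is no such element. *)
Definition max_of S : K := xget 0 [set M | S M /\ ubound S M].
Definition min_of S : K := xget 0 [set m | S m /\ lbound S m].

Definition dist_to u S : R := inf [set rabs (u - v) | v in S].

Definition hausdorff_dist (S1 S2 : set K) : R :=
  Num.max (sup [set dist_to u S2 | u in S1])
          (sup [set dist_to v S1 | v in S2]).

End ScalarSets.

Section Hilbert.
Variables (R : realType) (k : scalar_kind).
Local Notation K := (scalar_field R k).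
Variable H : completeNormedModType K.
Implicit Types (G : set H) (T : H -> H) (x y : H).

Definition closed_subspace G : Prop :=
  GRing.submod_closed [in G] /\ closed G.

(* [T] restricts to an element of B(G); its values outside [G] are irrelevant *)
Definition bounded_operator_on G T : Prop :=
  [/\ forall x, G x -> G (T x),
      forall (a : K) x y, G x -> G y -> T (a *: x + y) = a *: T x + T y
    & exists c : K, forall x, G x -> `|T x| <= c * `|x|].

(* spectrum of [T] regarded as an operator G -> G: the scalars [l] such that
   [T - l] has no inverse in B(G) *)
Definition spectrum_on G T : set K :=
  [set l | ~ exists S : H -> H,
     [/\ bounded_operator_on G S,
         forall x, G x -> S (T x - l *: x) = x
       & forall x, G x -> T (S x) - l *: S x = x]].

Definition spectrum T : set K := spectrum_on setT T.

Definition opnorm T : R := sup [set rnorm (T x) | x in [set x | rnorm x <= 1]].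

Definition invariant_subspace T G : Prop := forall x, G x -> G (T x).

Variable dot : {dot H for conj_scalar}.

Definition hilbert_dot : Prop := forall x, dot x x = `|x| ^+ 2.

Definition selfadjoint T : Prop := forall x y, dot (T x) y = dot x (T y).

Definition orthogonal_complement G : set H :=
  [set x | forall y, G y -> dot x y = 0].

Definition orthogonal_projector G x : H :=
  xget 0 [set y | G y /\ orthogonal_complement G (x - y)].

Definition corresponds_to_top T G : Prop :=
  orthogonal_complement G <> [set 0] ->
  max_of (spectrum_on (orthogonal_complement G) T)
    <= min_of (spectrum_on G T).

Definition corresponds_to_bottom T G : Prop :=
  corresponds_to_top (fun x => - T x) G.

Definition gap (F G : set H) : R :=
  opnorm (fun x => orthogonal_projector F x - orthogonal_projector G x).

End Hilbert.

(* Main.v *)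
Require Import Defs.
From mathcomp Require Import all_boot all_order all_algebra.
From mathcomp Require Import sesquilinear.
From mathcomp Require Import all_classical all_reals all_analysis.
From mathcomp Require Import complex.
From mathcomp Require Import ring lra.
Import Order.TTheory GRing.Theory Num.Theory.
Import numFieldNormedType.Exports.

(** The proof moves along a chain of four operators: [A] on [F], [TF] on [F],
    [TG] on [G] and the compression [P_G A] on [G].  Suppose [F] is the top part and
    let [mu] be the least point of the spectrum of [A] on [F], and [m], [M] the
    extreme points of the spectrum of [A].  Shift [A] to [W = A - c] with [c]
    slightly below [mu], so that [W] is strictly positive on [F] and almost
    nonpositive on the orthogonal complement of [F].  Up to the shift by [c],
    [TF] is [P_F P_G W] on [F] and [TG] is [P_G W P_F] on [G].

    - [A] and [TF] are both symmetric for the inner product [<W x, y>] on [F], and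
      the form of their difference is [|W x - P_G W x|^2 <= gap^2 |W x|^2], hence
      at most [(M - c) gap^2 <W x, x>].  Changing the inner product replaces the
      square root of [W] that one would use to symmetrise [P_F P_G W].
    - [P_F] intertwines [TG] with [TF], and [P_G W] intertwines [TF] with [TG].  If
      [gap < 1] both maps are bounded below, so the two spectra coincide.
    - [P_G A] and [TG] are symmetric on [G], and the form of their difference at
      [x] is [<W y, y>] with [y = x - P_F x] orthogonal to [F] and
      [|y| <= gap |x|], hence at most [(c - m) gap^2 |x|^2] up to the small shift.

    A perturbation of a symmetric operator moves its spectrum by at most the norm of
    the perturbation ([approx_eigenvalue_perturbation]), so the two errors add up
    to [(M - m) gap^2], and the shift tends to [0].  If [gap >= 1] the bound is
    trivial since both spectra lie in [[m, M]].  The bottom case follows by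
    replacing [A] with [- A].

    Real and complex scalars are treated together through the real bilinear form
    [Re <x, y>].  The spectrum of a symmetric operator consists of its approximate
    eigenvalues, which are real ([spectrum_approx]); from there on everything is a
    comparison of real quadratic forms and no functional calculus is needed.  The
    only use of completeness is the least squares problem [least_squares], which
    yields both orthogonal projections and inverses. *)

Set Implicit Arguments.
Unset Strict Implicit.
Unset Printing Implicit Defensive.

Local Open Scope classical_set_scope.
Local Open Scope ring_scope.


(** * Real and complex scalars *)

Section Scalars.
Context {R : realType} {k : scalar_kind}.
Local Notation K := (scalar_field R k).
Implicit Types (s t : R) (a u v : K).

Lemma of_realD s t : of_real (s + t) = of_real s + of_real t :> K.
Proof. by case: k => //=; rewrite rmorphD. Qed.

Lemma of_realN t : of_real (- t) = - of_real t :> K.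
Proof. by case: k => //=; rewrite rmorphN. Qed.

Lemma of_realM s t : of_real (s * t) = of_real s * of_real t :> K.
Proof. by case: k => //=; rewrite rmorphM. Qed.

Lemma of_real0 : of_real 0 = 0 :> K.
Proof. by case: k. Qed.

Lemma of_real1 : of_real 1 = 1 :> K.
Proof. by case: k. Qed.

Lemma of_realK t : re_scalar (of_real t : K) = t.
Proof. by case: k. Qed.

Lemma ler_of_real s t : (of_real s <= of_real t :> K) = (s <= t).
Proof. by case: k => //=; rewrite lecR. Qed.

Lemma ltr_of_real s t : (of_real s < of_real t :> K) = (s < t).
Proof. by case: k => //=; rewrite ltcR. Qed.

Lemma re_scalarD u v : re_scalar (u + v) = re_scalar u + re_scalar v.
Proof. by case: k u v => //= u v; case: u v => [? ?] [? ?]. Qed.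

Lemma re_scalarM t u : re_scalar (of_real t * u) = t * re_scalar u.
Proof. by case: k u => //= u; case: u => ? ? /=; rewrite mul0r subr0. Qed.

Lemma re_scalar_conj u : re_scalar (conj_scalar u) = re_scalar u.
Proof. by case: k u => //= u; case: u. Qed.

Lemma ger0_of_real u : 0 <= u -> u = of_real (re_scalar u).
Proof.
by case: k u => //= u; rewrite lecE /= => /andP[/eqP u0 _]; case: u u0 => /= ? ? ->.
Qed.

Lemma conj_of_real t : conj_scalar (of_real t : K) = of_real t.
Proof. by case: k => //=; exact: conjc_real. Qed.

Lemma conj_scalarK u : conj_scalar (conj_scalar u) = u.
Proof. by case: k u => //= u; rewrite conjCK. Qed.

Lemma mul_conj u : conj_scalar u * u = of_real (rabs u ^+ 2).
Proof.
have := ger0_of_real (normr_ge0 u); rewrite /rabs.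
case: k u => /= u; first by rewrite real_normK ?num_real ?expr2.
by rewrite mulrC -normCK => -> /=; rewrite -rmorphXn.
Qed.

(** The difference is purely imaginary; over the reals it vanishes. *)
Lemma conj_imaginary u :
  conj_scalar (u - of_real (re_scalar u)) = - (u - of_real (re_scalar u)).
Proof.
case: k u => /= u; first by rewrite subrr oppr0.
change (conjc (u - (complex.Re u)%:C%C) = - (u - (complex.Re u)%:C%C)).
by case: u => x y /=; congr (Complex _ _) => /=; rewrite ?subrr ?oppr0 // ?addr0 ?subr0.
Qed.

Lemma rabs_ge0 u : 0 <= rabs u.
Proof. by have := normr_ge0 u; rewrite [`|u|]ger0_of_real// -of_real0 ler_of_real. Qed.

Lemma rabs_eq0 u : rabs u = 0 -> u = 0.
Proof.
by move=> u0; apply/normr0_eq0; rewrite [`|u|]ger0_of_real// -/(rabs u) u0 of_real0.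
Qed.

Lemma rabs_of_real t : rabs (of_real t : K) = `|t|.
Proof.
have /(congr1 re_scalar) := mul_conj (of_real t).
rewrite conj_of_real re_scalarM !of_realK -expr2 => tE.
by rewrite -sqrtr_sqr tE sqrtr_sqr ger0_norm// rabs_ge0.
Qed.
End Scalars.

Section RealNorm.
Context {R : realType} {k : scalar_kind}.
Local Notation K := (scalar_field R k).
Context {H : normedModType K}.
Implicit Types (x y : H) (a : K).

Lemma normr_rnorm x : `|x| = of_real (rnorm x).
Proof. exact/ger0_of_real. Qed.

Lemma rnorm_ge0 x : 0 <= rnorm x.
Proof. by rewrite -(@ler_of_real R k) of_real0 -normr_rnorm. Qed.

Lemma rnormD x y : rnorm (x + y) <= rnorm x + rnorm y.
Proof. by rewrite -(@ler_of_real R k) of_realD -!normr_rnorm ler_normD. Qed.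

Lemma rnormN x : rnorm (- x) = rnorm x.
Proof. by rewrite /rnorm normrN. Qed.

Lemma rnormZ a x : rnorm (a *: x) = rabs a * rnorm x.
Proof.
have /(congr1 re_scalar) := normrZ a x.
by rewrite [`|a|]ger0_of_real// re_scalarM.
Qed.

Lemma rnorm0 : rnorm (0 : H) = 0.
Proof. by rewrite /rnorm normr0 -(@of_real0 R k) of_realK. Qed.

Lemma rnorm_eq0 x : rnorm x = 0 -> x = 0.
Proof. by move=> x0; apply/normr0_eq0; rewrite normr_rnorm x0 of_real0. Qed.

Lemma rnormBC x y : rnorm (x - y) = rnorm (y - x).
Proof. by rewrite -rnormN opprB. Qed.
End RealNorm.

(** * Subspaces and bounded operators *)

Lemma exists_sqr_le (R : realType) (C e : R) : 0 < e ->
  exists2 t : R, 0 < t & C * t ^+ 2 <= e.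
Proof.
move=> e0; have C1 : 0 < `|C| + 1 by rewrite ltr_wpDl.
exists (Num.sqrt (e / (`|C| + 1))); first by rewrite sqrtr_gt0 divr_gt0.
rewrite sqr_sqrtr; last by rewrite divr_ge0// ltW.
rewrite mulrA ler_pdivrMr// mulrC ler_pM2l//.
by rewrite (le_trans (ler_norm C))// lerDl.
Qed.

Lemma exists_invn_lt (R : realType) (e : R) : 0 < e ->
  exists N : nat, forall n : nat, (N <= n)%N -> (n.+1%:R)^-1 < e.
Proof.
move=> e0; have [N _ NP] := near_infty_natSinv_lt (PosNum e0).
by exists N => n Nn; apply: NP.
Qed.

Section Subspaces.
Context {R : realType} {k : scalar_kind}.
Local Notation K := (scalar_field R k).
Context {H : completeNormedModType K}.
Implicit Types (x y : H) (a : K) (V : set H) (T : H -> H).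

Lemma subspaceZD V a x y : closed_subspace V -> V x -> V y -> V (a *: x + y).
Proof. by move=> [[_ VZD] _] /mem_set Vx /mem_set Vy; apply/set_mem/VZD. Qed.

Lemma subspace0 V : closed_subspace V -> V 0.
Proof. by move=> [[V0 _] _]; apply/set_mem. Qed.

Lemma subspaceD V x y : closed_subspace V -> V x -> V y -> V (x + y).
Proof. by move=> hV Vx Vy; rewrite -[x]scale1r; apply: subspaceZD. Qed.

Lemma subspaceZ V a x : closed_subspace V -> V x -> V (a *: x).
Proof.
by move=> hV Vx; rewrite -[_ *: _]addr0; apply: subspaceZD => //; apply: subspace0.
Qed.

Lemma subspaceN V x : closed_subspace V -> V x -> V (- x).
Proof. by move=> hV Vx; rewrite -scaleN1r; apply: subspaceZ. Qed.

Lemma subspaceB V x y : closed_subspace V -> V x -> V y -> V (x - y).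
Proof. by move=> hV Vx Vy; apply: subspaceD => //; apply: subspaceN. Qed.

Lemma subspace_nontrivial V : closed_subspace V -> V <> [set 0] ->
  exists2 x, V x & x != 0.
Proof.
move=> hV; apply: contra_notP => /forall2NP V0.
apply/seteqP; split=> [x Vx|_ ->]; last exact: subspace0.
by have [//|/negP/negPn/eqP] := V0 x.
Qed.

Lemma complete_closed V (u : nat -> H) : closed V -> (forall n, V (u n)) ->
  (forall e : R, 0 < e -> exists N : nat, forall n m,
     (N <= n)%N -> (N <= m)%N -> rnorm (u n - u m) < e) ->
  exists2 x, V x & forall e : R, 0 < e -> exists N : nat, forall n,
    (N <= n)%N -> rnorm (x - u n) < e.
Proof.
move=> Vcl Vu uC.
have : cauchy (u @ \oo).
  apply: cauchy_exP => e e0.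
  have eE := ger0_of_real (ltW e0).
  have [|N NP] := uC (re_scalar e).
    by rewrite -(@ltr_of_real R k) -eE of_real0.
  exists (u N); exists N => // n /= Nn.
  rewrite -ball_normE /=.
  by rewrite normr_rnorm eE ltr_of_real; apply: NP.
move=> /cauchy_cvgP/cvg_ex[x ux]; exists x.
  by apply: (closed_cvg V Vcl _ _ ux); exists 0%N => // n _; apply: Vu.
move=> e e0; have /cvgrPdist_lt/(_ (of_real e)) := ux.
rewrite -(@of_real0 R k) ltr_of_real => /(_ e0)[N _ NP]; exists N => n Nn.
by have := NP n Nn; rewrite /= normr_rnorm ltr_of_real.
Qed.

End Subspaces.

Section Operators.
Context {R : realType} {k : scalar_kind}.
Local Notation K := (scalar_field R k).
Context {H : completeNormedModType K}.
Implicit Types (x y : H) (a : K) (V : set H) (T : H -> H).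

Lemma operator_in V T x : bounded_operator_on V T -> V x -> V (T x).
Proof. by case=> h _ _; apply: h. Qed.

Lemma operatorD V T x y : closed_subspace V -> bounded_operator_on V T ->
  V x -> V y -> T (x + y) = T x + T y.
Proof. by move=> hV [_ TD _] Vx Vy; have := TD 1 x y Vx Vy; rewrite !scale1r. Qed.

Lemma operator0 V T : closed_subspace V -> bounded_operator_on V T -> T 0 = 0.
Proof.
move=> hV hT; have V0 := subspace0 hV.
have /eqP := operatorD hV hT V0 V0.
by rewrite addr0 -subr_eq0 opprD addNKr oppr_eq0 => /eqP.
Qed.

Lemma operatorZ V T a x : closed_subspace V -> bounded_operator_on V T ->
  V x -> T (a *: x) = a *: T x.
Proof.
move=> hV hT Vx; case: (hT) => _ TD _; have := TD a x 0 Vx (subspace0 hV).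
by rewrite (operator0 hV hT) !addr0.
Qed.

Lemma operatorB V T x y : closed_subspace V -> bounded_operator_on V T ->
  V x -> V y -> T (x - y) = T x - T y.
Proof.
move=> hV hT Vx Vy; rewrite (operatorD hV hT)//; last exact: subspaceN.
by rewrite -scaleN1r (operatorZ _ hV hT)// scaleN1r.
Qed.

Lemma operator_bounded V T : bounded_operator_on V T ->
  exists2 c : R, 0 < c & forall x, V x -> rnorm (T x) <= c * rnorm x.
Proof.
move=> [_ _ [c hc]]; exists (`|re_scalar c| + 1); first by rewrite ltr_wpDl.
move=> x Vx; have := hc x Vx; rewrite !normr_rnorm => le_c.
have x0 := rnorm_ge0 x.
have cx : rnorm (T x) <= re_scalar c * rnorm x.
  have : 0 <= c * of_real (rnorm x).
    by rewrite (le_trans _ le_c)// -(@of_real0 R k) ler_of_real rnorm_ge0.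
  move=> /ger0_of_real cE; move: le_c; rewrite cE ler_of_real => /le_trans; apply.
  by rewrite mulrC re_scalarM mulrC.
apply: (le_trans cx); apply: ler_wpM2r => //.
by rewrite (le_trans (ler_norm _))// lerDl.
Qed.

Lemma bounded_operator_intro V T (c : R) :
  (forall x, V x -> V (T x)) ->
  (forall a x y, V x -> V y -> T (a *: x + y) = a *: T x + T y) ->
  (forall x, V x -> rnorm (T x) <= c * rnorm x) ->
  bounded_operator_on V T.
Proof.
move=> TV TD Tc; split=> //; exists (of_real c) => x Vx.
by rewrite !normr_rnorm -of_realM ler_of_real; apply: Tc.
Qed.

Lemma operator_shift V T a : closed_subspace V -> bounded_operator_on V T ->
  bounded_operator_on V (fun x => T x - a *: x).
Proof.
move=> hV hT; have [c c0 Tc] := operator_bounded hT.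
apply: (@bounded_operator_intro _ _ (c + rabs a)).
- by move=> x Vx; apply: subspaceB => //; [apply: operator_in hT _|apply: subspaceZ].
- move=> u x y Vx Vy; rewrite (operatorD hV hT)//; last exact: subspaceZ.
  rewrite (operatorZ _ hV hT)// !scalerDr scalerN !scalerA [a * u]mulrC.
  by rewrite opprD addrACA.
- move=> x Vx; rewrite mulrDl (le_trans (rnormD _ _))// rnormN rnormZ lerD2r.
  exact: Tc.
Qed.

Lemma operator_comp V T T' : closed_subspace V -> bounded_operator_on V T ->
  bounded_operator_on V T' -> bounded_operator_on V (T \o T').
Proof.
move=> hV hT hT'; have [c c0 Tc] := operator_bounded hT.
have [c' c0' Tc'] := operator_bounded hT'.
have TV x := @operator_in _ _ x hT; have TV' x := @operator_in _ _ x hT'.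
apply: (@bounded_operator_intro _ _ (c * c')) => [x Vx|a x y Vx Vy|x Vx] /=.
- exact/TV/TV'.
- have [_ TD _] := hT; have [_ TD' _] := hT'.
  by rewrite TD'// TD//; apply: TV'.
- rewrite (le_trans (Tc _ (TV' _ Vx)))// -mulrA ler_pM2l//; exact: Tc'.
Qed.

End Operators.

(** * Inner products equivalent to the norm, and least squares *)

Section RealForms.
Context {R : realType} {k : scalar_kind}.
Local Notation K := (scalar_field R k).
Context {H : completeNormedModType K}.
Implicit Types (x y z : H) (a : K) (V : set H) (T E : H -> H) (b : H -> H -> R).

(** Such a form is the real part of a bounded Hermitian form.  [rform_adj] is what
    remains of sesquilinearity over the complex numbers, and makes orthogonality for
    the real part agree with orthogonality for the Hermitian form.  Positivity is a
    separate condition, [coercive_on], because the form [<W x, y>] of the proof is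
    positive on one subspace only. *)
Record real_form b : Prop := RealForm {
  rformC : forall x y, b x y = b y x;
  rformDl : forall x y z, b (x + y) z = b x z + b y z;
  rformZl : forall (t : R) x y, b (of_real t *: x) y = t * b x y;
  rform_adj : forall a x y, b (a *: x) y = b x (conj_scalar a *: y);
  rform_bounded : exists2 C, 0 < C & forall x, b x x <= C * rnorm x ^+ 2 }.

Definition coercive_on V b :=
  exists2 d, 0 < d & forall x, V x -> d * rnorm x ^+ 2 <= b x x.

Definition symmetric_on V b T := forall x y, V x -> V y -> b (T x) y = b x (T y).

Lemma rformNl b x y : real_form b -> b (- x) y = - b x y.
Proof.
move=> hb; rewrite -scaleN1r -(@of_real1 R k) -of_realN rformZl//.
by rewrite mulN1r.
Qed.

Lemma rformDr b x y z : real_form b -> b z (x + y) = b z x + b z y.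
Proof. by move=> hb; rewrite rformC// rformDl// !(rformC hb z). Qed.

Lemma rformNr b x y : real_form b -> b x (- y) = - b x y.
Proof. by move=> hb; rewrite rformC// rformNl// rformC. Qed.

Lemma rformZr b (t : R) x y : real_form b -> b x (of_real t *: y) = t * b x y.
Proof. by move=> hb; rewrite rformC// rformZl// rformC. Qed.

Definition rformE b (hb : real_form b) :=
  (fun x y z => rformDl hb x y z, fun x y z => rformDr x y z hb,
   fun x y => rformNl x y hb, fun x y => rformNr x y hb,
   fun t x y => rformZl hb t x y, fun t x y => rformZr t x y hb).

(** A minimising sequence for [b (y - E x) (y - E x)] is Cauchy by the parallelogram
    law, since [E] is bounded below for [b]; its limit satisfies the normal equation.
    With [E] the identity this is the orthogonal projection; when no nonzero vector is
    orthogonal to the range of [E] it shows that [E] is onto. *)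
Lemma least_squares b V E y : real_form b -> closed_subspace V ->
  bounded_operator_on V E ->
  (exists2 g, 0 < g & forall x, V x -> g * rnorm x ^+ 2 <= b (E x) (E x)) ->
  (forall x, V x -> 0 <= b (y - E x) (y - E x)) ->
  exists2 x, V x & forall v, V v -> b (y - E x) (E v) = 0.
Proof.
move=> hb hV hE [g g0 Eg] q_ge0.
have [C C0 bC] := rform_bounded hb; have [c c0 Ec] := operator_bounded hE.
pose q x := b (y - E x) (y - E x).
have inf_q : has_inf [set q x | x in V].
  split; first by exists (q 0), 0 => //; apply: subspace0.
  by exists 0 => _ [x Vx <-]; apply: q_ge0.
set d := inf [set q x | x in V].
have d_le x : V x -> d <= q x by move=> Vx; apply: ge_inf; [exact: inf_q.2|exists x].
have q_lt (n : nat) : exists x, V x /\ q x < d + (n.+1%:R)^-1.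
  have [|_ [x Vx <-] qx] := @inf_adherent _ _ (n.+1%:R)^-1 _ inf_q.
    by rewrite invr_gt0.
  by exists x.
have [u /all_and2[Vu qu]] := choice q_lt.
(* The midpoint of two near-minimisers is no better than the infimum. *)
have dist_u n m : g * rnorm (u n - u m) ^+ 2 <= 2 * (n.+1%:R)^-1 + 2 * (m.+1%:R)^-1.
  have Vmid : V (of_real 2^-1 *: (u n + u m)) by apply: subspaceZ => //; apply: subspaceD.
  have := d_le _ Vmid; rewrite /q (operatorZ _ hV hE)//; last exact: subspaceD.
  rewrite (operatorD hV hE)// => mid.
  have := Eg _ (subspaceB hV (Vu n) (Vu m)) => /le_trans; apply.
  rewrite (operatorB hV hE)//.
  have := qu n; have := qu m; move: mid; rewrite /q !(rformE hb) => mid un um.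
  rewrite ![b (E _) y](rformC hb) in mid un um *.
  rewrite [b (E (u m)) (E (u n))](rformC hb) in mid *.
  move: (n.+1%:R^-1) (m.+1%:R^-1) un um => in_ im_ un um. lra.
have [|x Vx ux] := complete_closed hV.2 Vu.
  move=> e e0; have ge0 : 0 < g * e ^+ 2 / 4 by rewrite divr_gt0// mulr_gt0// exprn_gt0.
  have [N NP] := exists_invn_lt ge0; exists N => n m Nn Nm.
  have : g * rnorm (u n - u m) ^+ 2 < g * e ^+ 2.
    rewrite (le_lt_trans (dist_u n m))//; have := NP n Nn; have := NP m Nm.
    by move: (n.+1%:R^-1) (m.+1%:R^-1) => in_ im_; lra.
  by rewrite ltr_pM2l// ltr_pXn2r// nnegrE ?rnorm_ge0// ltW.
exists x => // v Vv.
have Ev0 : 0 <= b (E v) (E v).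
  by apply: le_trans (Eg _ Vv); rewrite mulr_ge0 ?exprn_ge0 ?rnorm_ge0// ltW.
(* First variation of the squared distance in the direction v; e absorbs the error of
   replacing x by a term of the sequence. *)
have var t : 2 * t * b (y - E x) (E v) <= 2 * (t ^+ 2 * b (E v) (E v)).
  apply/ler_addgt0Pr => e e0.
  have e20 : 0 < e / 2 by rewrite divr_gt0.
  have [s s0 sC] := exists_sqr_le (C * c ^+ 2) e20.
  have [N NP] := exists_invn_lt e20; have [N' NP'] := ux s s0.
  pose n := maxn N N'; have := NP n (leq_maxl _ _); have := NP' n (leq_maxr _ _).
  move: (n.+1%:R^-1) (qu n) => in_ qun uns nlt; have Vh := subspaceB hV Vx (Vu n).
  have Eh : b (E (x - u n)) (E (x - u n)) <= e / 2.
    apply: le_trans (bC _) _; apply: le_trans _ sC.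
    have Ehs : rnorm (E (x - u n)) <= c * s.
      by rewrite (le_trans (Ec _ Vh))// ler_pM2l// ltW.
    rewrite -mulrA ler_pM2l// -exprMn.
    by apply: lerXn2r => //; rewrite nnegrE ?rnorm_ge0// (le_trans _ Ehs)// rnorm_ge0.
  have Vtv : V (of_real t *: v) by exact: subspaceZ.
  have := d_le _ (subspaceD hV (Vu n) Vtv); move: qun.
  rewrite /q (operatorD hV hE)// (operatorZ _ hV hE)//.
  have := Eg _ (subspaceD hV Vh Vtv).
  rewrite (operatorD hV hE)// (operatorZ _ hV hE)//.
  move: Eh; rewrite (operatorB hV hE)// => Eh.
  have : 0 <= g * rnorm (x - u n + of_real t *: v) ^+ 2.
    by rewrite mulr_ge0 ?exprn_ge0 ?rnorm_ge0// ltW.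
  move=> /le_trans h /h {h}; move: Eh; rewrite !(rformE hb).
  rewrite ![b (E _) y](rformC hb) ![b (E (u n)) (E x)](rformC hb).
  rewrite ![b (E v) _](rformC hb).
  lra.
set B := b (E v) (E v) in Ev0 var; set be := b (y - E x) (E v) in var *.
have B1 : 0 < B + 1 by rewrite ltr_wpDl.
(* The bound var is quadratic in t on the right, and this t makes both sides
   multiples of t ^+ 2. *)
set t := be / (B + 1); have tE : be = t * (B + 1) by rewrite divfK// gt_eqF.
have := var t; rewrite {1}tE => h.
have : t ^+ 2 <= 0 by lra.
by rewrite le_eqVlt ltNge sqr_ge0 orbF sqrf_eq0 tE => /eqP ->; rewrite mul0r.
Qed.

End RealForms.

(** * The spectrum of a symmetric operator *)

Section ApproximateSpectrum.
Context {R : realType} {k : scalar_kind}.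
Local Notation K := (scalar_field R k).
Context {H : completeNormedModType K}.
Implicit Types (x y z : H) (V : set H) (T P : H -> H) (b : H -> H -> R).

(** The strict inequality forces [x] to be nonzero. *)
Definition approx_eigenvalue V T (l : R) := forall g : R, 0 < g ->
  exists2 x, V x & rnorm (T x - of_real l *: x) < g * rnorm x.

Lemma form_ge0 b V x : coercive_on V b -> V x -> 0 <= b x x.
Proof.
move=> [d d0 hd] /hd; apply: le_trans.
by rewrite mulr_ge0 ?exprn_ge0 ?rnorm_ge0// ltW.
Qed.

Lemma form_eq0 b V x : coercive_on V b -> V x -> b x x <= 0 -> x = 0.
Proof.
move=> [d d0 hd] /hd dx x0; have := le_trans dx x0; rewrite pmulr_rle0// => x2.
by apply: rnorm_eq0; apply/eqP; rewrite -sqrf_eq0 eq_le x2 sqr_ge0.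
Qed.

Lemma form_below_norm b V (h : R) : real_form b -> coercive_on V b -> 0 < h ->
  exists2 g, 0 < g &
    forall u x, V x -> h * b x x <= b u u -> g * rnorm x <= rnorm u.
Proof.
move=> hb [d d0 hd] h0; have [C C0 bC] := rform_bounded hb.
exists (Num.sqrt (h * d / C)) => [|u x Vx hx].
  by rewrite sqrtr_gt0 divr_gt0// mulr_gt0.
rewrite -[leRHS]ger0_norm ?rnorm_ge0// -[leRHS]sqrtr_sqr.
rewrite -[in leLHS](ger0_norm (rnorm_ge0 x)) -sqrtr_sqr -sqrtrM; last first.
  by rewrite divr_ge0 ?mulr_ge0 ?ltW.
apply: ler_wsqrtr; rewrite mulrAC ler_pdivrMr// mulrC [leRHS]mulrC.
have := hd x Vx; have := bC u; rewrite -(ler_pM2l h0); nra.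
Qed.

Lemma norm_below_form b V (g : R) : real_form b -> coercive_on V b -> 0 < g ->
  exists2 h, 0 < h &
    forall u x, V u -> g * rnorm x <= rnorm u -> h * b x x <= b u u.
Proof.
move=> hb [d d0 hd] g0; have [C C0 bC] := rform_bounded hb.
exists (g ^+ 2 * d / C) => [|u x Vu gx].
  by rewrite divr_gt0// mulr_gt0// exprn_gt0.
have gx2 : g ^+ 2 * rnorm x ^+ 2 <= rnorm u ^+ 2.
  rewrite -exprMn; apply: lerXn2r => //; rewrite nnegrE ?rnorm_ge0//.
  by rewrite mulr_ge0 ?rnorm_ge0// ltW.
rewrite mulrAC ler_pdivrMr// (le_trans (y := C * (d * rnorm u ^+ 2)))//; last first.
  by rewrite [leRHS]mulrC ler_pM2l// hd.
rewrite (le_trans (y := g ^+ 2 * d * (C * rnorm x ^+ 2)))//.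
  by rewrite ler_pM2l// mulr_gt0// exprn_gt0.
have -> : g ^+ 2 * d * (C * rnorm x ^+ 2) = C * (d * (g ^+ 2 * rnorm x ^+ 2)) by ring.
by rewrite !ler_pM2l.
Qed.

(** Being an approximate eigenvalue does not depend on which of the equivalent norms
    is used, which is what allows the inner product to change along the proof. *)
Lemma approx_eigenvalue_form b V T (l : R) : real_form b -> coercive_on V b ->
    closed_subspace V -> bounded_operator_on V T ->
  approx_eigenvalue V T l <-> forall h, 0 < h -> exists2 x, V x &
    b (T x - of_real l *: x) (T x - of_real l *: x) < h * b x x.
Proof.
move=> hb cV hV hT; have hE := operator_shift (of_real l) hV hT.
split=> ae.
  move=> h h0; have [g g0 gh] := form_below_norm hb cV h0.
  have [x Vx lt_x] := ae g g0; exists x => //; rewrite ltNge.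
  by apply/negP => /(gh _ _ Vx); rewrite leNgt lt_x.
move=> g g0; have [h h0 hg] := norm_below_form hb cV g0.
have [x Vx lt_x] := ae h h0; exists x => //; rewrite ltNge.
by apply/negP => /(hg _ _ (operator_in hE Vx)); rewrite leNgt lt_x.
Qed.

Lemma symmetric_shift b V T (t : R) : real_form b ->
  symmetric_on V b T -> symmetric_on V b (fun x => T x - of_real t *: x).
Proof. by move=> hb sT x y Vx Vy; rewrite !(rformE hb) sT. Qed.

Section BoundedBelow.
Variables (b : H -> H -> R) (V : set H) (T : H -> H).
Hypotheses (hb : real_form b) (cV : coercive_on V b) (hV : closed_subspace V).
Hypotheses (hT : bounded_operator_on V T) (sT : symmetric_on V b T).

(** [T - l] and its adjoint [T - conj l] have the same form norm because [T] is
    symmetric.  So both are injective, and the solution of the least squares problem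
    for [T - l] has residual [0]: the residual is in the kernel of the adjoint. *)
Lemma spectrum_bounded_below (l : K) (g : R) : 0 < g ->
  (forall x, V x -> g * rnorm x <= rnorm (T x - l *: x)) -> ~ spectrum_on V T l.
Proof.
move=> g0 gE nS; apply: nS.
pose E x := T x - l *: x.
have {}gE x : V x -> g * rnorm x <= rnorm (E x) by exact: gE.
have hE : bounded_operator_on V E := operator_shift l hV hT.
pose E' x := T x - conj_scalar l *: x.
have hE' : bounded_operator_on V E' := operator_shift _ hV hT.
have EV x : V x -> V (E x) by exact: operator_in.
have EV' x : V x -> V (E' x) by exact: operator_in.
have adjE x y : V x -> V y -> b (E' x) y = b x (E y).
  by move=> Vx Vy; rewrite /E /E' !(rformE hb) (rform_adj hb) conj_scalarK sT.
have TZ a x : V x -> T (a *: x) = a *: T x by exact: operatorZ.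
have norm_adj x : V x -> b (E' x) (E' x) = b (E x) (E x).
  move=> Vx.
  have cross : b (T x) (l *: x) = b (conj_scalar l *: x) (T x).
    by rewrite sT ?TZ ?(rform_adj hb) ?conj_scalarK//; exact: subspaceZ.
  have sqr : b (conj_scalar l *: x) (conj_scalar l *: x) = b (l *: x) (l *: x).
    by rewrite !(rform_adj hb) !scalerA conj_scalarK mulrC.
  rewrite /E /E' !(rformE hb) sqr cross (rformC hb (T x) (_ *: x)).
  by rewrite (rformC hb (l *: x) (T x)) cross.
have E0 x : V x -> E x = 0 -> x = 0.
  move=> Vx Ex; apply: rnorm_eq0; apply/eqP; rewrite eq_le rnorm_ge0 andbT.
  by have := gE x Vx; rewrite Ex rnorm0 pmulr_rle0.
have E'0 x : V x -> E' x = 0 -> x = 0.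
  move=> Vx Ex; apply: (E0 x Vx); apply: (form_eq0 cV (EV x Vx)).
  by rewrite -norm_adj// Ex -(scale0r 0) -(@of_real0 R k) rformZl// mul0r.
have E_onto y : V y -> exists x, V x /\ E x = y.
  move=> Vy; have [||x Vx xP] := least_squares (y := y) hb hV hE.
  - have [h h0 hP] := norm_below_form hb cV g0.
    have [d d0 dP] := cV; exists (h * d) => [|x Vx]; first by rewrite mulr_gt0.
    by rewrite (le_trans _ (hP _ _ (EV _ Vx) (gE _ Vx)))// -mulrA ler_pM2l// dP.
  - by move=> x Vx; apply: (form_ge0 cV); apply: subspaceB => //; apply: EV.
  exists x; split=> //; apply/esym/eqP; rewrite -subr_eq0; apply/eqP.
  have Vw : V (y - E x) by apply: subspaceB => //; exact: EV.
  apply: (E'0 _ Vw); apply: (form_eq0 cV (EV' _ Vw)).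
  by rewrite adjE ?xP//; [exact: EV'|exact: EV'].
have EB x y : V x -> V y -> E (x - y) = E x - E y by exact: operatorB.
have E_inj x y : V x -> V y -> E x = E y -> x = y.
  move=> Vx Vy Exy; apply/eqP; rewrite -subr_eq0; apply/eqP/E0.
    exact: subspaceB.
  by rewrite EB// Exy subrr.
pose S y := xget 0 [set x | V x /\ E x = y].
have SP y : V y -> V (S y) /\ E (S y) = y.
  by move=> Vy; exact: (xgetPex 0 (E_onto _ Vy)).
have [_ ED _] := hE.
exists S; split=> [|x Vx|x Vx].
- apply: (@bounded_operator_intro _ _ _ _ _ g^-1).
  + by move=> x /SP[].
  + move=> a x y Vx Vy; have [VSx ESx] := SP x Vx; have [VSy ESy] := SP y Vy.
    have [VS ES] := SP _ (subspaceZD a hV Vx Vy).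
    by apply: E_inj => //; [exact: subspaceZD|rewrite ES ED// ESx ESy].
  + move=> x Vx; have [VSx ESx] := SP x Vx.
    by rewrite mulrC ler_pdivlMr// mulrC -{2}ESx gE.
- by have [VS ES] := SP _ (EV x Vx); exact: E_inj.
- by have [VS ES] := SP _ Vx.
Qed.

(** If [a] is the imaginary part of [l], then [(T - re l) x] and [a x] are orthogonal
    for the real form, so that [T - l] is bounded below by [|a|]. *)
Lemma spectrum_real (l : K) : spectrum_on V T l -> l = of_real (re_scalar l).
Proof.
move=> Sl; apply: contrapT => l_nreal.
set a := l - of_real (re_scalar l); have a0 : 0 < rabs a.
  rewrite lt_neqAle rabs_ge0 andbT eq_sym; apply/eqP => /rabs_eq0/eqP.
  by rewrite subr_eq0 => /eqP.
have a2 : 0 < rabs a ^+ 2 by rewrite exprn_gt0.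
have [g g0 gP] := form_below_norm hb cV a2.
apply: (spectrum_bounded_below g0 _ Sl) => x Vx; apply: gP => //.
set u := T x - of_real (re_scalar l) *: x.
have -> : T x - l *: x = u - a *: x.
  by rewrite /u /a scalerBl opprB addrA subrK.
have au : b u (a *: x) = 0.
  have : b (a *: x) u =
      b x (T (conj_scalar a *: x) - of_real (re_scalar l) *: (conj_scalar a *: x)).
    rewrite (rform_adj hb) (operatorZ _ hV hT)// scalerBr !scalerA.
    by rewrite [_ * of_real _]mulrC.
  rewrite conj_imaginary -/a -(symmetric_shift _ hb sT)//; last exact: subspaceZ.
  by rewrite scaleNr rformNr// (rformC hb (a *: x)) -/u; lra.
have Vu : V u := operator_in (operator_shift (of_real (re_scalar l)) hV hT) Vx.
clearbody u; rewrite !(rformE hb) au (rformC hb (a *: x) u) au.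
rewrite (rform_adj hb a) scalerA mul_conj (rformE hb).
by have := form_ge0 cV Vu; lra.
Qed.

Lemma spectrum_approx (l : K) : spectrum_on V T l <->
  exists2 t : R, l = of_real t & approx_eigenvalue V T t.
Proof.
split=> [Sl|[t -> ae] [S [hS ST _]]].
  have lE := spectrum_real Sl; exists (re_scalar l) => // g g0.
  apply: contrapT => nx; apply: (spectrum_bounded_below g0 _ Sl) => x Vx.
  by rewrite leNgt; apply/negP => lt_x; apply: nx; exists x => //; rewrite -lE.
have [c c0 Sc] := operator_bounded hS.
have ci : 0 < c^-1 by rewrite invr_gt0.
have [x Vx] := ae _ ci; rewrite mulrC ltr_pdivlMr// mulrC ltNge => /negP; apply.
rewrite -{1}(ST x Vx); apply: Sc.
exact: (operator_in (operator_shift _ hV hT)).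
Qed.

End BoundedBelow.
End ApproximateSpectrum.

(** * Rayleigh quotients and perturbation of the spectrum *)

Section Rayleigh.
Context {R : realType} {k : scalar_kind}.
Local Notation K := (scalar_field R k).
Context {H : completeNormedModType K}.
Implicit Types (x y z : H) (V : set H) (T P : H -> H) (b : H -> H -> R).

Variables (b : H -> H -> R) (V : set H).
Hypotheses (hb : real_form b) (cV : coercive_on V b) (hV : closed_subspace V).

Lemma operator_form_bounded P : bounded_operator_on V P ->
  exists2 C, 0 < C & forall x, V x -> `|b (P x) x| <= C * b x x.
Proof.
move=> hP; have [c c0 Pc] := operator_bounded hP.
have [C C0 bC] := rform_bounded hb; have [d d0 bd] := cV.
exists (C * (c ^+ 2 + 1) / d).
  by rewrite divr_gt0// mulr_gt0// ltr_pwDr// sqr_ge0.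
move=> x Vx; have VPx := operator_in hP Vx.
have Pc2 : rnorm (P x) ^+ 2 <= c ^+ 2 * rnorm x ^+ 2.
  rewrite -exprMn; apply: lerXn2r; rewrite ?nnegrE ?rnorm_ge0 ?Pc//.
  by rewrite mulr_ge0 ?rnorm_ge0// ltW.
have bound : b (P x) (P x) + b x x <= C * (c ^+ 2 + 1) * rnorm x ^+ 2.
  by have := bC x; have := bC (P x); nra.
have cross : `|b (P x) x| <= b (P x) (P x) + b x x.
  have := form_ge0 cV (subspaceD hV VPx Vx).
  have := form_ge0 cV (subspaceB hV VPx Vx).
  rewrite !(rformE hb) [b x (P x)](rformC hb) => ? ?.
  have := form_ge0 cV Vx; have := form_ge0 cV VPx.
  by rewrite ler_norml => ? ?; apply/andP; split; lra.
rewrite (le_trans cross)// (le_trans bound)// [leRHS]mulrAC -[leRHS]mulrA ler_wpM2l//.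
  by rewrite mulr_ge0 ?ltW// ltr_pwDr// sqr_ge0.
by rewrite ler_pdivlMr// mulrC bd.
Qed.

(** With [u = C x - P x] and [v = P x], the nonnegative number
    [b (P u) u + C b v v - b (P v) v] equals [C (C b (P x) x - b (P x) (P x))]. *)
Lemma positive_operator_sqr P (C : R) : bounded_operator_on V P ->
  symmetric_on V b P -> 0 < C -> (forall x, V x -> 0 <= b (P x) x <= C * b x x) ->
  forall x, V x -> b (P x) (P x) <= C * b (P x) x.
Proof.
move=> hP sP C0 PC x Vx; rewrite -subr_ge0 -(pmulr_rge0 _ C0).
have VPx := operator_in hP Vx; have VPPx := operator_in hP VPx.
have VCx : V (of_real C *: x) := subspaceZ _ hV Vx.
have /andP[+ _] := PC _ (subspaceB hV VCx VPx).
have /andP[_ +] := PC _ VPx.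
rewrite (operatorB hV hP)// (operatorZ _ hV hP)// !(rformE hb).
rewrite [b (P (P x)) x](sP _ _ VPx Vx).
lra.
Qed.

(** Polarisation: the bound comes from the difference of the quadratic form of [P] at
    [r x + P x] and at [r x - P x]. *)
Lemma numerical_radius_norm P (r : R) : bounded_operator_on V P ->
  symmetric_on V b P -> 0 < r -> (forall x, V x -> `|b (P x) x| <= r * b x x) ->
  forall x, V x -> b (P x) (P x) <= r ^+ 2 * b x x.
Proof.
move=> hP sP r0 Pr x Vx; have VPx := operator_in hP Vx.
have Vrx : V (of_real r *: x) := subspaceZ _ hV Vx.
have := Pr _ (subspaceD hV Vrx VPx); have := Pr _ (subspaceB hV Vrx VPx).
rewrite (operatorB hV hP)// (operatorD hV hP)// (operatorZ _ hV hP)//.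
rewrite !(rformE hb) [b (P (P x)) x](sP _ _ VPx Vx) [b (P x) x](sP _ _ Vx Vx).
rewrite !ler_norml => /andP[lo _] /andP[_ hi]; move: lo hi => lo hi.
by rewrite -(ler_pM2l r0); lra.
Qed.

Lemma approx_eigenvalue_ge P (c l : R) : bounded_operator_on V P ->
  (forall x, V x -> c * b x x <= b (P x) x) -> approx_eigenvalue V P l -> c <= l.
Proof.
move=> hP Pc /(approx_eigenvalue_form l hb cV hV hP) ae; rewrite leNgt; apply/negP => lc.
have dlt : 0 < (c - l) ^+ 2 by rewrite exprn_gt0// subr_gt0.
have [x Vx] := ae _ dlt; set u := P x - _; rewrite ltNge => /negP; apply.
have Vu : V u := operator_in (operator_shift (of_real l) hV hP) Vx.
have uc : (c - l) * b x x <= b u x by rewrite /u !(rformE hb); have := Pc x Vx; lra.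
have := form_ge0 cV (subspaceB hV Vu (subspaceZ (of_real (c - l)) hV Vx)).
clearbody u; rewrite !(rformE hb) [b x u](rformC hb); nra.
Qed.

Hypothesis V0 : V <> [set 0].

(** With [m] the infimum of the Rayleigh quotient, [P - m] is positive, so
    [positive_operator_sqr] bounds [(P - m) x] by the excess of the quotient at [x]. *)
Lemma rayleigh_inf P : bounded_operator_on V P -> symmetric_on V b P ->
  exists2 m, approx_eigenvalue V P m & forall x, V x -> m * b x x <= b (P x) x.
Proof.
move=> hP sP; have [C C0 PC] := operator_form_bounded hP.
have pos x : V x -> x != 0 -> 0 < b x x.
  move=> Vx x0; rewrite ltNge; apply: contra x0 => bx.
  by apply/eqP/(form_eq0 cV Vx bx).
pose Q := [set b (P x) x / b x x | x in [set x | V x /\ x != 0]].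
have infQ : has_inf Q.
  split.
    have [x Vx x0] := subspace_nontrivial hV V0.
    by exists (b (P x) x / b x x), x.
  exists (- C) => _ [x [Vx x0] <-]; rewrite ler_pdivlMr ?pos//.
  by have := PC x Vx; rewrite ler_norml mulNr => /andP[].
have m_le x : V x -> inf Q * b x x <= b (P x) x.
  move=> Vx; have [->|x0] := eqVneq x 0.
    by rewrite -(scale0r 0) -(@of_real0 R k) !(rformE hb) !mul0r mulr0.
  by rewrite -ler_pdivlMr ?pos//; apply: ge_inf; [exact: infQ.2|exists x].
exists (inf Q) => //; set m := inf Q in m_le *.
apply/(approx_eigenvalue_form m hb cV hV hP) => h h0.
have C1 : 0 < C + `|m| by rewrite ltr_pwDl.
have hP' := operator_shift (of_real m) hV hP.
have [|_ [x [Vx x0] <-]] := @inf_adherent _ _ (h / (C + `|m|)) _ infQ.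
  by rewrite divr_gt0.
rewrite ltr_pdivrMr ?pos// -/m => lt_x; exists x => //.
apply: le_lt_trans (positive_operator_sqr hP' (symmetric_shift _ hb sP) C1 _ Vx) _.
  move=> y Vy; rewrite !(rformE hb); have := m_le y Vy; have := PC y Vy.
  have := form_ge0 cV Vy; have := ler_norm (- m); rewrite normrN ler_norml.
  by move=> ? ? /andP[? ?] ?; apply/andP; split; nra.
rewrite mulrC -ltr_pdivlMr// !(rformE hb).
by move: lt_x; rewrite mulrAC; lra.
Qed.

(** Let [E = P' - l] and let [m] be the least point of the spectrum of [E ^ 2].  Since
    [E ^ 2 - m = (E - sqrt m) (E + sqrt m)] is not bounded below, one of
    [l + sqrt m], [l - sqrt m] is an approximate eigenvalue of [P'].  Evaluating
    [E] at an approximate eigenvector of [P] for [l] gives [m <= r ^ 2]. *)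
Lemma approx_eigenvalue_perturbation P P' (r l : R) :
  bounded_operator_on V P -> symmetric_on V b P ->
  bounded_operator_on V P' -> symmetric_on V b P' -> 0 < r ->
  (forall x, V x -> `|b (P x - P' x) x| <= r * b x x) ->
  approx_eigenvalue V P l ->
  exists2 l', approx_eigenvalue V P' l' & `|l - l'| <= r.
Proof.
move=> hP sP hP' sP' r0 Dr /(approx_eigenvalue_form l hb cV hV hP) ae.
pose E x := P' x - of_real l *: x; pose D x := P x - P' x.
have hE : bounded_operator_on V E := operator_shift (of_real l) hV hP'.
have sE : symmetric_on V b E := symmetric_shift _ hb sP'.
have EV x : V x -> V (E x) := @operator_in _ _ _ _ _ x hE.
have hD : bounded_operator_on V D.
  have [c c0 Pc] := operator_bounded hP; have [c' c0' Pc'] := operator_bounded hP'.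
  apply: (@bounded_operator_intro _ _ _ _ _ (c + c')).
  - move=> x Vx; apply: subspaceB => //; first exact: operator_in hP _.
    exact: operator_in hP' _.
  - move=> a x y Vx Vy; rewrite /D; have [_ PD _] := hP; have [_ PD' _] := hP'.
    by rewrite PD// PD'// opprD addrACA scalerBr.
  - by move=> x Vx; rewrite mulrDl (le_trans (rnormD _ _))// rnormN lerD ?Pc ?Pc'.
have sD : symmetric_on V b D by move=> x y Vx Vy; rewrite /D !(rformE hb) sP// sP'.
have D_norm := numerical_radius_norm hD sD r0 Dr.
have hEE := operator_comp hV hE hE.
have sEE : symmetric_on V b (E \o E).
  by move=> x y Vx Vy /=; rewrite sE ?sE//; exact: EV.
have [m ae_m m_le] := rayleigh_inf hEE sEE.
have m0 : 0 <= m.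
  apply: (approx_eigenvalue_ge hEE _ ae_m) => x Vx /=.
  by rewrite mul0r (sE _ _ (EV _ Vx) Vx); exact: form_ge0 cV (EV _ Vx).
have mr : m <= r ^+ 2.
  apply/ler_addgt0Pr => e e0.
  (* t and h are the weights for which the two Young terms add up to r ^+ 2 + e. *)
  pose t := e / (2 * r ^+ 2); have r20 : 0 < r ^+ 2 by rewrite exprn_gt0.
  have t0 : 0 < t by rewrite divr_gt0// mulr_gt0.
  pose h := e / (2 * (1 + t^-1)).
  have ti0 : 0 < 1 + t^-1 by rewrite addr_gt0// invr_gt0.
  have h0 : 0 < h by rewrite divr_gt0// mulr_gt0.
  have [x Vx lt_x] := ae h h0.
  have bx : 0 < b x x.
    rewrite -(pmulr_rgt0 _ h0); apply: le_lt_trans lt_x.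
    exact/(form_ge0 cV)/(operator_in (operator_shift (of_real l) hV hP)).
  rewrite -(ler_pM2r bx); have := m_le x Vx; rewrite /= (sE _ _ (EV _ Vx) Vx).
  move=> /le_trans; apply.
  set u := P x - of_real l *: x in lt_x.
  have -> : E x = u - D x by rewrite /E /u /D opprB [RHS]addrC addrA subrK.
  have VD : V (D x) := operator_in hD Vx.
  have Vu : V u := operator_in (operator_shift (of_real l) hV hP) Vx.
  have Db := D_norm x Vx; clearbody u D.
  have young : b (u - D x) (u - D x) <= (1 + t^-1) * b u u + (1 + t) * b (D x) (D x).
    have := form_ge0 cV (subspaceD hV Vu (subspaceZ (of_real t) hV VD)).
    rewrite !(rformE hb) [b (D x) u](rformC hb) => sq.
    have : 0 <= t^-1 * (b u u + t * b u (D x) + t * (b u (D x) + t * b (D x) (D x))).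
      by rewrite mulr_ge0// ?invr_ge0 ?(ltW t0)//; move: sq; lra.
    have -> : t^-1 * (b u u + t * b u (D x) + t * (b u (D x) + t * b (D x) (D x))) =
      t^-1 * b u u + 2 * b u (D x) + t * b (D x) (D x) by field; rewrite gt_eqF.
    lra.
  apply: (le_trans young); rewrite [leRHS]mulrDl.
  have -> : e * b x x = (1 + t^-1) * (h * b x x) + t * (r ^+ 2 * b x x).
    have -> : (1 + t^-1) * (h * b x x) = e / 2 * b x x.
      by rewrite /h; move: ti0; generalize (1 + t^-1) => w w0; field; rewrite gt_eqF.
    have -> : t * (r ^+ 2 * b x x) = e / 2 * b x x.
      by rewrite /t; field; rewrite gt_eqF. 
    by field.
  have : (1 + t^-1) * b u u <= (1 + t^-1) * (h * b x x) by rewrite ler_pM2l// ltW.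
  have : (1 + t) * b (D x) (D x) <= (1 + t) * (r ^+ 2 * b x x).
    by rewrite ler_pM2l// addr_gt0.
  lra.
pose s := Num.sqrt m; have s0 : 0 <= s := sqrtr_ge0 m.
have sr : s <= r.
  by rewrite -(ger0_norm (ltW r0)) -sqrtr_sqr ler_wsqrtr.
have EB x y : V x -> V y -> E (x - y) = E x - E y by exact: operatorB.
have factor x : V x -> E (E x + of_real s *: x) - of_real s *: (E x + of_real s *: x)
   = E (E x) - of_real m *: x.
  move=> Vx; have Vsx : V (of_real s *: x) by exact: subspaceZ.
  rewrite (operatorD hV hE (EV x Vx) Vsx) (operatorZ _ hV hE Vx).
  move: (E (E x)) (E x) => u v.
  by rewrite scalerDr scalerA -of_realM -expr2 sqr_sqrtr// opprD addrA addrK.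
have shift t x : P' x - of_real (l + t) *: x = E x - of_real t *: x.
  by rewrite of_realD scalerDl opprD addrA.
apply: contrapT => nae.
have below t : `|t| <= r ->
    exists2 g, 0 < g & forall x, V x -> g * rnorm x <= rnorm (E x - of_real t *: x).
  move=> tr; apply: contrapT => nb; apply: nae; exists (l + t).
    move=> g g0; apply: contrapT => nx; apply: nb; exists g => // x Vx.
    by rewrite leNgt; apply/negP => lt_x; apply: nx; exists x => //; rewrite shift.
  by rewrite opprD addrA subrr add0r normrN.
have [|g1 g10 g1P] := below s; first by rewrite ger0_norm.
have [|g2 g20 g2P] := below (- s); first by rewrite normrN ger0_norm.
have [x Vx] := ae_m (g1 * g2) (mulr_gt0 g10 g20); rewrite ltNge => /negP; apply.
rewrite /= -factor//; have VEs : V (E x + of_real s *: x).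
  by apply: subspaceD => //; [exact: EV|exact: subspaceZ].
apply: le_trans (g1P _ VEs); rewrite -mulrA ler_pM2l//.
by have := g2P x Vx; rewrite of_realN scaleNr opprK.
Qed.

End Rayleigh.

Section Intertwining.
Context {R : realType} {k : scalar_kind}.
Context {H : completeNormedModType (scalar_field R k)}.

(** [Z] carries approximate eigenvectors of [P] to approximate eigenvectors of
    [P']; the lower bound on [Z] keeps them away from [0]. *)
Lemma approx_eigenvalue_intertwining (V V' : set H) (P P' Z : H -> H) (c g l : R) :
  (forall x, V x -> V' (Z x)) ->
  (forall x, V x -> Z (P x - of_real l *: x) = P' (Z x) - of_real l *: Z x) ->
  bounded_operator_on V P -> closed_subspace V -> 0 < c -> 0 < g ->
  (forall x, V x -> rnorm (Z x) <= c * rnorm x) ->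
  (forall x, V x -> g * rnorm x <= rnorm (Z x)) ->
  approx_eigenvalue V P l -> approx_eigenvalue V' P' l.
Proof.
move=> ZV ZP hP hV c0 g0 Zc Zg ae e e0.
have eg0 : 0 < e * g / c by rewrite divr_gt0// mulr_gt0.
have [x Vx lt_x] := ae _ eg0; exists (Z x); first exact: ZV.
rewrite -ZP//; apply: le_lt_trans (Zc _ (operator_in (operator_shift _ hV hP) Vx)) _.
rewrite mulrC -ltr_pdivlMr//; apply: (lt_le_trans lt_x).
by rewrite mulrAC ler_pM2r ?invr_gt0// -mulrA ler_pM2l// Zg.
Qed.
End Intertwining.

Section Extrema.
Context {R : realType} {k : scalar_kind}.
Local Notation K := (scalar_field R k).
Context {H : completeNormedModType K}.
Variables (b : H -> H -> R) (V : set H) (P : H -> H).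
Hypotheses (hb : real_form b) (cV : coercive_on V b) (hV : closed_subspace V).
Hypotheses (V0 : V <> [set 0]) (hP : bounded_operator_on V P) (sP : symmetric_on V b P).

Lemma operatorN : bounded_operator_on V (fun x => - P x).
Proof.
have [c c0 Pc] := operator_bounded hP; apply: (bounded_operator_intro (c := c)).
- by move=> x Vx; apply: subspaceN => //; exact: operator_in hP Vx.
- by move=> a x y Vx Vy; have [_ -> //] := hP; rewrite opprD scalerN.
- by move=> x Vx; rewrite rnormN Pc.
Qed.

Lemma approx_eigenvalueN (Q : H -> H) (l : R) :
  approx_eigenvalue V Q l -> approx_eigenvalue V (fun x => - Q x) (- l).
Proof.
move=> ae g g0; have [x Vx lt_x] := ae g g0; exists x => //.
by rewrite of_realN scaleNr -opprD rnormN.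
Qed.

Lemma spectrum_extrema : exists m M : R,
  [/\ max_of (spectrum_on V P) = of_real M, min_of (spectrum_on V P) = of_real m,
      approx_eigenvalue V P m, approx_eigenvalue V P M
    & forall x, V x -> m * b x x <= b (P x) x <= M * b x x].
Proof.
have [m ae_m m_le] := rayleigh_inf hb cV hV V0 hP sP.
have hN := operatorN.
have sN : symmetric_on V b (fun x => - P x).
  by move=> x y Vx Vy; rewrite !(rformE hb) sP.
have [M' ae_M' M_le] := rayleigh_inf hb cV hV V0 hN sN.
have ae_M : approx_eigenvalue V P (- M').
  by move=> g g0; have [x Vx] := approx_eigenvalueN ae_M' g0; rewrite opprK; exists x.
have mem (t : R) : approx_eigenvalue V P t -> spectrum_on V P (of_real t).
  by move=> ae; apply/(spectrum_approx hb cV hV hP sP); exists t.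
exists m, (- M'); split=> //.
- have ub : ubound (spectrum_on V P) (of_real (- M')).
    move=> _ /(spectrum_approx hb cV hV hP sP)[t -> ae]; rewrite ler_of_real lerNr.
    by apply: (approx_eigenvalue_ge hb cV hV hN M_le); exact: approx_eigenvalueN.
  apply: xget_unique; first by split=> //; exact: mem.
  by move=> y [Sy yub]; apply/eqP; rewrite eq_le ub//= yub//; exact: mem.
- have lb : lbound (spectrum_on V P) (of_real m).
    move=> _ /(spectrum_approx hb cV hV hP sP)[t -> ae]; rewrite ler_of_real.
    exact: (approx_eigenvalue_ge hb cV hV hP m_le).
  apply: xget_unique; first by split=> //; exact: mem.
  by move=> y [Sy ylb]; apply/eqP; rewrite eq_le lb//= ylb//; exact: mem.
- move=> x Vx; rewrite m_le//=; have := M_le x Vx.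
  by rewrite !(rformE hb) mulNr lerNr.
Qed.
End Extrema.

(** * Orthogonal projectors *)

Section RealInnerProduct.
Context {R : realType} {k : scalar_kind}.
Local Notation K := (scalar_field R k).
Context {H : completeNormedModType K}.
Variable dot : {dot H for (@conj_scalar R k)}.
Hypothesis Hdot : hilbert_dot dot.
Implicit Types (x y z : H) (G V : set H) (a : K).

Definition rdot x y : R := re_scalar (dot x y).

Lemma rdotxx x : rdot x x = rnorm x ^+ 2.
Proof.
by rewrite /rdot Hdot normr_rnorm expr2 -of_realM of_realK.
Qed.

Lemma real_form_rdot : real_form rdot.
Proof.
have herm x y : dot x y = conj_scalar (dot y x).
  by rewrite hermitian_subproof expr0 mul1r.
split.
- by move=> x y; rewrite /rdot herm re_scalar_conj.
- by move=> x y z; rewrite /rdot linearDl re_scalarD.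
- by move=> t x y; rewrite /rdot linearZl_LR re_scalarM.
- by move=> a x y; rewrite /rdot linearZl_LR linearZr_LR /= conj_scalarK.
- by exists 1 => // x; rewrite mul1r rdotxx.
Qed.

Lemma coercive_rdot V : coercive_on V rdot.
Proof. by exists 1 => // x _; rewrite mul1r rdotxx. Qed.

Let hr := real_form_rdot.

(** Testing against [a *: y] with [a = dot x y] recovers the full scalar product from
    its real part. *)
Lemma complement_rdotP G x : closed_subspace G ->
  (forall y, G y -> rdot x y = 0) -> orthogonal_complement dot G x.
Proof.
move=> hG xG y Gy; set a := dot x y.
have := xG _ (subspaceZ a hG Gy); rewrite /rdot linearZr_LR /= -/a mul_conj of_realK.
by move=> /eqP; rewrite sqrf_eq0 => /eqP/rabs_eq0.
Qed.

Lemma complement_rdot G x y : orthogonal_complement dot G x -> G y -> rdot x y = 0.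
Proof. by move=> xG Gy; rewrite /rdot xG// -(@of_real0 R k) of_realK. Qed.

Section Projector.
Variables (G : set H) (hG : closed_subspace G).
Local Notation p := (orthogonal_projector dot G).
Local Notation Gc := (orthogonal_complement dot G).

Lemma projectorP x : G (p x) /\ Gc (x - p x).
Proof.
have hid : bounded_operator_on G id.
  by apply: (bounded_operator_intro (c := 1)) => // y _; rewrite mul1r.
have [||y Gy yP] := least_squares (y := x) hr hG hid.
- by exists 1 => // y _; rewrite mul1r rdotxx.
- by move=> y _; rewrite rdotxx exprn_ge0// rnorm_ge0.
apply: (@xgetPex _ 0 [set y | G y /\ Gc (x - y)]); exists y; split=> //.
exact: complement_rdotP.
Qed.

Lemma projector_in x : G (p x). Proof. by have [] := projectorP x. Qed.

Lemma projector_complement x : Gc (x - p x). Proof. by have [] := projectorP x. Qed.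

Lemma rdot_projector x z : G z -> rdot (p x) z = rdot x z.
Proof.
move=> Gz; have := complement_rdot (projector_complement x) Gz.
by rewrite !(rformE hr) => /eqP; rewrite subr_eq0 => /eqP.
Qed.

Lemma projector_unique x y : G y -> (forall z, G z -> rdot y z = rdot x z) -> p x = y.
Proof.
move=> Gy yP; apply/eqP; rewrite -subr_eq0; apply/eqP.
have Gd : G (p x - y) by apply: subspaceB => //; exact: projector_in.
apply: (form_eq0 (coercive_rdot G) Gd).
by rewrite (rformDl hr) (rformNl _ _ hr) rdot_projector// yP// subrr.
Qed.

Lemma projector_id x : G x -> p x = x.
Proof. by move=> Gx; apply: projector_unique. Qed.

Lemma projector_eq0 x : Gc x -> p x = 0.
Proof.
move=> Gcx; apply: projector_unique => [|z Gz]; first exact: subspace0.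
by rewrite (complement_rdot Gcx Gz) -(scale0r 0) -(@of_real0 R k) (rformZl hr) mul0r.
Qed.

Lemma projectorZD a x y : p (a *: x + y) = a *: p x + p y.
Proof.
apply: projector_unique => [|z Gz]; first by apply: subspaceZD => //; exact: projector_in.
rewrite !(rformDl hr) !(rform_adj hr) !rdot_projector//; exact: subspaceZ.
Qed.

Lemma projectorB x y : p (x - y) = p x - p y.
Proof. by rewrite addrC -scaleN1r projectorZD scaleN1r addrC. Qed.

Lemma projectorZ a x : p (a *: x) = a *: p x.
Proof.
by rewrite -[a *: x]addr0 projectorZD (projector_id (subspace0 hG)) addr0.
Qed.

Lemma rdot_projector_sym x y : rdot (p x) y = rdot x (p y).
Proof.
rewrite -(rdot_projector x (projector_in y)) !(rformC hr (p x)).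
by rewrite rdot_projector//; exact: projector_in.
Qed.

Lemma projector_pythagoras x :
  rdot (x - p x) (x - p x) = rdot x x - rdot (p x) (p x).
Proof.
have := rdot_projector x (projector_in x).
by rewrite !(rformE hr) (rformC hr (p x) x); lra.
Qed.

Lemma rnorm_projector x : rnorm (p x) <= rnorm x.
Proof.
rewrite -(ler_pXn2r (n := 2)) ?nnegrE ?rnorm_ge0// -!rdotxx -subr_ge0.
by rewrite -projector_pythagoras rdotxx exprn_ge0// rnorm_ge0.
Qed.

(** The complement is the kernel of the projector, which is a contraction. *)
Lemma complement_closed : closed_subspace Gc.
Proof.
split; first split.
- by apply/mem_set => y Gy; rewrite linear0l.
- move=> a x y /set_mem xG /set_mem yG; apply/mem_set => z Gz.
  by rewrite linearDl linearZl_LR /= xG// yG// mulr0 addr0.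
- move=> x xcl; suff x0 : p x = 0 by rewrite -[x]subr0 -x0; exact: projector_complement.
  apply: rnorm_eq0; apply/eqP; rewrite eq_le rnorm_ge0 andbT.
  apply/ler_addgt0Pr => e e0; rewrite add0r.
  have eK : 0 < of_real e :> K by rewrite -(@of_real0 R k) ltr_of_real.
  have [y [yG]] := xcl _ (nbhsx_ballx x _ eK).
  rewrite -ball_normE /= normr_rnorm ltr_of_real => /ltW; apply: le_trans.
  by rewrite -[p x]subr0 -(projector_eq0 yG) -projectorB rnorm_projector.
Qed.
End Projector.
End RealInnerProduct.

(** * The chain of operators between a top subspace and its approximation *)

Section CloseSpectra.
Context {R : realType} {k : scalar_kind}.
Local Notation K := (scalar_field R k).
Context {H : completeNormedModType K}.
Variable dot : {dot H for (@conj_scalar R k)}.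
Hypothesis Hdot : hilbert_dot dot.
Implicit Types (x y z : H) (F G V : set H) (A P : H -> H).
Local Notation r := (rdot dot).
Local Notation proj := (orthogonal_projector dot).
Let hr := real_form_rdot Hdot.

Lemma hausdorff_dist_le (S1 S2 : set K) (e : R) : S1 !=set0 -> S2 !=set0 ->
  (forall u, S1 u -> exists2 v, S2 v & rabs (u - v) <= e) ->
  (forall v, S2 v -> exists2 u, S1 u & rabs (v - u) <= e) ->
  hausdorff_dist S1 S2 <= e.
Proof.
have one_sided (S S' : set K) : S !=set0 ->
    (forall u, S u -> exists2 v, S' v & rabs (u - v) <= e) ->
    sup [set dist_to u S' | u in S] <= e.
  move=> [u0 Su0] near; apply: ge_sup; first by exists (dist_to u0 S'), u0.
  move=> _ [u Su <-]; have [v Sv uv] := near u Su.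
  apply: le_trans uv; apply: ge_inf; last by exists v.
  by exists 0 => _ [w _ <-]; exact: rabs_ge0.
by move=> S10 S20 h1 h2; rewrite /hausdorff_dist ge_max !one_sided.
Qed.

Lemma whole_subspace : closed_subspace [set: H].
Proof. by split; [split=> [|a x y _ _]; exact: mem_set|exact: closedT]. Qed.

Lemma operator_restrict V A : bounded_operator_on setT A ->
  (forall x, V x -> V (A x)) -> bounded_operator_on V A.
Proof.
move=> hA AV; have [c _ Ac] := operator_bounded hA; have [_ AD _] := hA.
by apply: (bounded_operator_intro (c := c)) => // *; [exact: AD|exact: Ac].
Qed.

Lemma projector_operator G : closed_subspace G -> bounded_operator_on setT (proj G).
Proof.
move=> hG; apply: (bounded_operator_intro (c := 1)) => // [a x y _ _|x _].
  exact: projectorZD.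
by rewrite mul1r; exact: rnorm_projector.
Qed.

Lemma compression_operator A G : closed_subspace G -> bounded_operator_on setT A ->
  bounded_operator_on G (fun x => proj G (A x)).
Proof.
move=> hG hA; have hpG := projector_operator hG.
have hGA : bounded_operator_on setT (fun x => proj G (A x)).
  exact: (operator_comp whole_subspace hpG hA).
by apply: (operator_restrict hGA) => x _; exact: projector_in.
Qed.

Lemma compression_symmetric A G : closed_subspace G -> symmetric_on setT r A ->
  symmetric_on G r (fun x => proj G (A x)).
Proof.
move=> hG sA x y Gx Gy; rewrite (rdot_projector Hdot hG _ Gy) sA//.
by rewrite [RHS](rformC hr) (rdot_projector Hdot hG _ Gx) (rformC hr).
Qed.

(** One half of a bound on the Hausdorff distance of two spectra. *)
Definition spectra_within V P V' P' (e : R) := forall l, approx_eigenvalue V P l ->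
  exists2 l', approx_eigenvalue V' P' l' & `|l - l'| <= e.

Section Top.
Variables (A : H -> H) (F G : set H).
Hypotheses (hA : bounded_operator_on setT A) (sA : symmetric_on setT r A).
Hypotheses (hF : closed_subspace F) (hG : closed_subspace G).
Hypotheses (F0 : F <> [set 0]) (G0 : G <> [set 0]).
Hypothesis AF : invariant_subspace A F.
Variables (m mu M s : R).
Hypotheses (m_mu : m <= mu) (mu_M : mu <= M) (s0 : 0 <= s) (s1 : s < 1).
Hypothesis A_bounds : forall x, m * r x x <= r (A x) x <= M * r x x.
Hypothesis A_top : forall x, F x -> mu * r x x <= r (A x) x.
Hypothesis A_rest : forall x, orthogonal_complement dot F x -> r (A x) x <= mu * r x x.
Hypothesis F_near_G : forall x, F x -> rnorm (x - proj G x) <= s * rnorm x.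
Hypothesis G_near_F : forall x, G x -> rnorm (x - proj F x) <= s * rnorm x.
Variable e : R.
Hypothesis e0 : 0 < e.

(** The shift stays below [mu] by [e] so that [W] is coercive on [F] and can serve as
    an inner product there. *)
Let c := mu - e.
Let W x := A x - of_real c *: x.
Let hT := whole_subspace.
Let hW : bounded_operator_on setT W := operator_shift (of_real c) hT hA.
Let sW : symmetric_on setT r W := symmetric_shift c hr sA.
Let WF x : F x -> F (W x).
Proof. by move=> Fx; apply: subspaceB => //; [exact: AF|exact: subspaceZ]. Qed.
Let WsymE x y : r (W x) y = r x (W y). Proof. exact: sW. Qed.

Let hWF : bounded_operator_on F W := operator_restrict hW WF.

Let B x y := r (W x) y.

Let W_lower x : F x -> e * r x x <= r (W x) x.
Proof. by move=> Fx; have := A_top Fx; rewrite /W /c !(rformE hr); lra. Qed.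

Let W_upper x : r (W x) x <= (M - c) * r x x.
Proof. by have /andP[_] := A_bounds x; rewrite /W /c !(rformE hr); lra. Qed.

Let Mc0 : 0 < M - c. Proof. by move: mu_M e0; rewrite /c; lra. Qed.

Let hB : real_form B.
Proof.
have WD x y : W (x + y) = W x + W y by exact: (operatorD hT hW).
have WZ a x : W (a *: x) = a *: W x by exact: (operatorZ a hT hW).
split; rewrite /B.
- by move=> x y; rewrite WsymE (rformC hr).
- by move=> x y z; rewrite WD (rformDl hr).
- by move=> t x y; rewrite WZ (rformZl hr).
- by move=> a x y; rewrite WZ (rform_adj hr).
- by exists (M - c) => // x; rewrite -(rdotxx Hdot); exact: W_upper.
Qed.

Let cF : coercive_on F B.
Proof. by exists e => // x Fx; rewrite -(rdotxx Hdot); exact: W_lower. Qed.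

Let W_norm x : F x -> r (W x) (W x) <= (M - c) * r (W x) x.
Proof.
move=> Fx; apply: (positive_operator_sqr hr hF hWF _ Mc0 _ Fx) => [y z _ _|y Fy].
  exact: WsymE.
rewrite W_upper andbT (le_trans _ (W_lower Fy))// mulr_ge0 ?(ltW e0)//.
exact: form_ge0 (coercive_rdot Hdot F) Fy.
Qed.

(** Adding [c] back makes [TF] comparable with [A] on [F], and [TG] with the
    compression [ritz] on [G]; the common shift keeps them intertwined. *)
Let TF x := proj F (proj G (W x)) - of_real (- c) *: x.
Let TG x := proj G (W (proj F x)) - of_real (- c) *: x.
Let ritz x := proj G (A x).

Let hpF := projector_operator hF.
Let hpG := projector_operator hG.

Let hTF : bounded_operator_on F TF.
Proof.
apply: (operator_shift (of_real (- c)) hF).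
apply: (operator_restrict (operator_comp hT hpF (operator_comp hT hpG hW))) => x _ /=.
exact: (projector_in Hdot hF).
Qed.

Let hTG : bounded_operator_on G TG.
Proof.
apply: (operator_shift (of_real (- c)) hG).
apply: (operator_restrict (operator_comp hT hpG (operator_comp hT hW hpF))) => x _ /=.
exact: (projector_in Hdot hG).
Qed.

Let hRitz : bounded_operator_on G ritz := compression_operator hG hA.

Let sAF : symmetric_on F B A.
Proof.
move=> x y _ _; rewrite /B WsymE sA// -!/(W _).
have AW : W (A y) = A (W y).
  by rewrite /W (operatorB hT hA)// (operatorZ _ hT hA).
by rewrite -AW WsymE.
Qed.

Let sTF : symmetric_on F B TF.
Proof.
apply: (symmetric_shift (- c) hB) => x y Fx Fy; rewrite /B.
rewrite WsymE (rdot_projector Hdot hF _ (WF Fy)) (rdot_projector_sym Hdot hG).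
rewrite [RHS](rformC hr) (rdot_projector Hdot hF _ (WF Fx)).
by rewrite (rformC hr).
Qed.

Let sTG : symmetric_on G r TG.
Proof.
apply: (symmetric_shift (- c) hr) => x y Gx Gy.
have WpF z : F (W (proj F z)) := WF (projector_in Hdot hF z).
rewrite (rdot_projector Hdot hG _ Gy) (rformC hr x) (rdot_projector Hdot hG _ Gx).
rewrite (rformC hr _ y) (rformC hr _ x) -(rdot_projector Hdot hF y (WpF x)).
by rewrite -(rdot_projector Hdot hF x (WpF y)) -WsymE (rformC hr).
Qed.

Let sRitz : symmetric_on G r ritz := compression_symmetric hG sA.

Let dF := (M - c) * s ^+ 2 + e.
Let dG := (mu - m + e) * s ^+ 2 + e.

Let dF_gt0 : 0 < dF.
Proof. by rewrite /dF ltr_wpDl// mulr_ge0 ?sqr_ge0 ?ltW. Qed.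

Let dG_gt0 : 0 < dG.
Proof. by rewrite /dG ltr_wpDl// mulr_ge0 ?sqr_ge0// addr_ge0 ?subr_ge0 ?(ltW e0). Qed.

Let sqr_le x y : rnorm x <= s * rnorm y -> r x x <= s ^+ 2 * r y y.
Proof.
by move=> xy; rewrite !(rdotxx Hdot) -exprMn; apply: lerXn2r => //;
  rewrite nnegrE ?rnorm_ge0// mulr_ge0// rnorm_ge0.
Qed.

(** The form of [A - TF] at [x] is [|W x - P_G W x| ^ 2], and [W x] is in [F]. *)
Let A_near_TF x : F x -> `|B (A x - TF x) x| <= dF * B x x.
Proof.
move=> Fx; have FWx := WF Fx.
have -> : A x - TF x = W x - proj F (proj G (W x)).
  by rewrite /TF /W of_realN scaleNr opprK opprD addrA addrAC.
have -> : B (W x - proj F (proj G (W x))) x = r (W x - proj G (W x)) (W x - proj G (W x)).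
  rewrite /B WsymE (projector_pythagoras Hdot hG) (rformDl hr) (rformNl _ _ hr).
  rewrite (rdot_projector Hdot hF _ FWx) (rformC hr (proj G (W x)) (W x)).
  by rewrite -(rdot_projector Hdot hG (W x) (projector_in Hdot hG (W x))).
rewrite ger0_norm; last exact: (form_ge0 (coercive_rdot Hdot setT) I).
have := sqr_le (F_near_G FWx); have := W_norm Fx.
have bx : 0 <= B x x := form_ge0 cF Fx.
have ebx : 0 <= e * B x x by rewrite mulr_ge0// ltW.
move=> h1 h2; rewrite /dF mulrDl (le_trans h2)//.
have : s ^+ 2 * r (W x) (W x) <= s ^+ 2 * ((M - c) * r (W x) x).
  by rewrite ler_wpM2l// sqr_ge0.
by move: ebx; rewrite /B; lra.
Qed.

(** Only the part [y] of [x] orthogonal to [F] contributes, because [W] preserves both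
    [F] and its complement; there [W] lies between [m - c] and [e]. *)
Let TG_near_ritz x : G x -> `|r (TG x - ritz x) x| <= dG * r x x.
Proof.
move=> Gx; set y := x - proj F x.
have Fy : orthogonal_complement dot F y by exact: projector_complement.
have FWp : F (W (proj F x)) := WF (projector_in Hdot hF x).
have WB u v : W (u - v) = W u - W v by exact: (operatorB hT hW).
have -> : TG x - ritz x = - proj G (W y).
  have pWx : proj G (W x) = proj G (A x) - of_real c *: x.
    rewrite /W (projectorB Hdot hG); congr (_ - _).
    by apply: projector_id => //; exact: subspaceZ.
  rewrite /TG /ritz of_realN scaleNr opprK /y WB (projectorB Hdot hG) opprB pWx opprB.
  by rewrite addrA.
have -> : r (- proj G (W y)) x = - r (W y) y.
  rewrite (rformNl _ _ hr) (rdot_projector Hdot hG _ Gx); congr (- _).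
  rewrite -[x](subrK (proj F x)) -/y (rformDr _ _ _ hr) (WsymE y (proj F x)).
  by rewrite (complement_rdot Fy FWp) addr0.
have yx := sqr_le (G_near_F Gx); rewrite -/y in yx.
have yy : 0 <= r y y := form_ge0 (coercive_rdot Hdot setT) I.
have xx : 0 <= e * r x x.
  by rewrite mulr_ge0 ?(ltW e0)//; exact: (form_ge0 (coercive_rdot Hdot setT) I).
have Wy : `|r (W y) y| <= (mu - m + e) * r y y.
  have /andP[lo _] := A_bounds y; have hi := A_rest Fy.
  have m_mu_y : 0 <= (mu - m) * r y y by rewrite mulr_ge0// subr_ge0.
  have e_y : 0 <= e * r y y by rewrite mulr_ge0// ltW.
  move: lo hi m_mu_y e_y; rewrite /W /c !(rformE hr) ler_norml => *.
  by apply/andP; split; lra.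
rewrite normrN (le_trans Wy)// /dG mulrDl.
have : (mu - m + e) * r y y <= (mu - m + e) * (s ^+ 2 * r x x).
  by rewrite ler_wpM2l// addr_ge0 ?subr_ge0// ltW.
by move: xx; lra.
Qed.

Let W_bounded_below x : F x -> e * rnorm x <= rnorm (W x).
Proof.
move=> Fx; rewrite -(ler_pXn2r (n := 2)) ?nnegrE ?mulr_ge0 ?(ltW e0) ?rnorm_ge0//.
rewrite exprMn -!(rdotxx Hdot).
have := form_ge0 (coercive_rdot Hdot setT) (I : setT (W x - of_real e *: x)).
have : e * (e * r x x) <= e * r (W x) x by rewrite ler_pM2l// W_lower.
move: (W x) => w; rewrite !(rformE hr) (rformC hr x w); lra.
Qed.

(** This is where [s < 1] matters: the projection is then injective with a lower bound. *)
Let bounded_below_of_near V x : rnorm (x - proj V x) <= s * rnorm x ->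
  (1 - s) * rnorm x <= rnorm (proj V x).
Proof.
move=> near; have := rnormD (x - proj V x) (proj V x); rewrite subrK; lra.
Qed.

Let projZB V x a y : closed_subspace V -> proj V (x - a *: y) = proj V x - a *: proj V y.
Proof.
by move=> hV; rewrite (projectorB Hdot hV) (projectorZ Hdot hV).
Qed.

Let TF_to_TG l : approx_eigenvalue F TF l -> approx_eigenvalue G TG l.
Proof.
have [cW cW0 Wc] := operator_bounded hW.
have WZB x a y : W (x - a *: y) = W x - a *: W y.
  by rewrite (operatorB hT hW)// (operatorZ _ hT hW).
apply: (approx_eigenvalue_intertwining (Z := fun x => proj G (W x))
  (c := cW) (g := (1 - s) * e)) => //.
- by move=> x _; exact: projector_in.
- by move=> x Fx; rewrite /TF /TG !WZB !projZB.
- by rewrite mulr_gt0// subr_gt0.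
- by move=> x _; rewrite (le_trans (rnorm_projector Hdot hG _))// Wc.
move=> x Fx; rewrite (le_trans _ (bounded_below_of_near (F_near_G (WF Fx))))//.
by rewrite -mulrA ler_wpM2l ?W_bounded_below// subr_ge0 ltW.
Qed.

Let TG_to_TF l : approx_eigenvalue G TG l -> approx_eigenvalue F TF l.
Proof.
apply: (approx_eigenvalue_intertwining (Z := proj F) (c := 1) (g := 1 - s)) => //.
- by move=> x _; exact: projector_in.
- by move=> x Gx; rewrite /TF /TG !projZB.
- by rewrite subr_gt0.
- by move=> x _; rewrite mul1r; exact: rnorm_projector.
- by move=> x Gx; apply: bounded_below_of_near (G_near_F Gx).
Qed.

(** The errors [dF] and [dG] are incurred in turn, and [mu] cancels in their sum. *)
Lemma top_spectra_within :
  let t := (M - m) * s ^+ 2 + e * (2 * s ^+ 2 + 2) in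
  spectra_within F A G (fun x => proj G (A x)) t /\
  spectra_within G (fun x => proj G (A x)) F A t.
Proof.
move=> t; have hAF := operator_restrict hA AF.
have tE : t = dF + dG by rewrite /t /dF /dG /c; ring.
have dist_le a b1 b2 (l l1 l2 : R) : `|l - l1| <= b1 -> `|l1 - l2| <= b2 -> a = b1 + b2 ->
    `|l - l2| <= a.
  by move=> h1 h2 ->; rewrite (le_trans (ler_distD l1 _ _))// lerD.
have ritz_near_TG x : G x -> `|r (ritz x - TG x) x| <= dG * r x x.
  by move=> Gx; rewrite -opprB (rformNl _ _ hr) normrN TG_near_ritz.
have TF_near_A x : F x -> `|B (TF x - A x) x| <= dF * B x x.
  by move=> Fx; rewrite -opprB (rformNl _ _ hB) normrN A_near_TF.
rewrite tE; split=> l ae.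
  have [l1 /TF_to_TG ae1 l1P] :=
    approx_eigenvalue_perturbation hB cF hF F0 hAF sAF hTF sTF dF_gt0 A_near_TF ae.
  have [l2 ae2 l2P] :=
    approx_eigenvalue_perturbation hr (coercive_rdot Hdot G) hG G0
      hTG sTG hRitz sRitz dG_gt0 TG_near_ritz ae1.
  by exists l2 => //; apply: dist_le l1P l2P _.
have [l1 /TG_to_TF ae1 l1P] :=
  approx_eigenvalue_perturbation hr (coercive_rdot Hdot G) hG G0
    hRitz sRitz hTG sTG dG_gt0 ritz_near_TG ae.
have [l2 ae2 l2P] :=
    approx_eigenvalue_perturbation hB cF hF F0 hTF sTF hAF sAF dF_gt0 TF_near_A ae1.
by exists l2 => //; apply: dist_le l1P l2P _; rewrite addrC.
Qed.
End Top.
End CloseSpectra.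

(** * The gap and the conclusion *)

Section Gap.
Context {R : realType} {k : scalar_kind}.
Local Notation K := (scalar_field R k).
Context {H : completeNormedModType K}.
Variable dot : {dot H for (@conj_scalar R k)}.
Hypothesis Hdot : hilbert_dot dot.
Local Notation r := (rdot dot).
Local Notation proj := (orthogonal_projector dot).
Let hr := real_form_rdot Hdot.
Implicit Types (x y : H) (F G : set H) (A : H -> H).

Lemma rnorm_gap F G x : closed_subspace F -> closed_subspace G ->
  rnorm (proj F x - proj G x) <= gap dot F G * rnorm x.
Proof.
move=> hF hG; have [->|x0] := eqVneq x 0.
  by rewrite !projector_id ?subrr ?rnorm0 ?mulr0//; exact: subspace0.
have nx : 0 < rnorm x.
  by rewrite lt_neqAle rnorm_ge0 andbT eq_sym; apply: contra x0 => /eqP/rnorm_eq0 ->.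
pose y := of_real (rnorm x)^-1 *: x.
have ny : rnorm y <= 1.
  by rewrite rnormZ rabs_of_real ger0_norm ?invr_ge0 ?rnorm_ge0// mulVf// gt_eqF.
have -> : proj F x - proj G x = of_real (rnorm x) *: (proj F y - proj G y).
  rewrite !(projectorZ Hdot)// -scalerBr scalerA -of_realM divff ?gt_eqF//.
  by rewrite of_real1 scale1r.
rewrite rnormZ rabs_of_real ger0_norm ?rnorm_ge0// mulrC ler_pM2r//.
apply: ub_le_sup; last by exists y.
(* The supremum defining the gap is over a set bounded by 2. *)
exists 2 => _ [z /= nz <-]; rewrite (le_trans (rnormD _ _))// rnormN.
have := rnorm_projector Hdot hF z; have := rnorm_projector Hdot hG z; lra.
Qed.

Lemma selfadjoint_symmetric A V : selfadjoint dot A -> symmetric_on V r A.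
Proof. by move=> sA x y _ _; rewrite /rdot sA. Qed.

(** If [s >= 1] the bound exceeds the length of the interval [[m, M]], which contains
    both spectra.  Otherwise [mu], the least point of the spectrum on [F], bounds the
    form of [A] from below on [F] and, by the top condition, from above on the
    complement. *)
Lemma spectra_within_gap A F G (m M s : R) :
    bounded_operator_on setT A -> symmetric_on setT r A ->
    closed_subspace F -> F <> [set 0] -> closed_subspace G -> G <> [set 0] ->
    invariant_subspace A F -> corresponds_to_top dot A F ->
    (forall x, m * r x x <= r (A x) x <= M * r x x) ->
    (forall x, rnorm (proj F x - proj G x) <= s * rnorm x) ->
  forall e, 0 < e ->
  spectra_within F A G (fun x => proj G (A x)) ((M - m) * s ^+ 2 + e) /\
  spectra_within G (fun x => proj G (A x)) F A ((M - m) * s ^+ 2 + e).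
Proof.
move=> hA sA hF F0 hG G0 AF top bnd near e e0.
have hAF := operator_restrict hA AF.
have sAF : symmetric_on F r A by move=> x y _ _; exact: sA.
have hAG := compression_operator Hdot hG hA.
have sAG := compression_symmetric Hdot hG sA.
have cr V : coercive_on V r := coercive_rdot Hdot V.
(* Both spectra lie in the numerical range of A, hence in [m, M]. *)
have range V P l : closed_subspace V -> bounded_operator_on V P ->
    (forall x, V x -> r (P x) x = r (A x) x) -> approx_eigenvalue V P l -> m <= l <= M.
  move=> hV hP PA ae; apply/andP; split.
    apply: (approx_eigenvalue_ge hr (cr V) hV hP _ ae) => x Vx.
    by rewrite PA//; have /andP[] := bnd x.
  rewrite -lerN2; have ae' := approx_eigenvalueN ae.
  apply: (approx_eigenvalue_ge hr (cr V) hV (operatorN hV hP) _ ae') => x Vx.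
  by rewrite (rformNl _ _ hr) mulNr lerN2 PA//; have /andP[] := bnd x.
have rangeF l : approx_eigenvalue F A l -> m <= l <= M by apply: range.
have rangeG l : approx_eigenvalue G (fun x => proj G (A x)) l -> m <= l <= M.
  by apply: range => // x Gx; rewrite rdot_projector.
have [mu [MF [_ muE ae_mu _ mu_le]]] := spectrum_extrema hr (cr F) hF F0 hAF sAF.
have [mG [_ [_ _ ae_mG _ _]]] := spectrum_extrema hr (cr G) hG G0 hAG sAG.
have /andP[m_mu mu_M] := rangeF _ ae_mu.
have s_ge0 : 0 <= s.
  have [x Fx x0] := subspace_nontrivial hF F0.
  have := le_trans (rnorm_ge0 _) (near x); rewrite pmulr_lge0//.
  rewrite lt_neqAle rnorm_ge0 andbT eq_sym.
  by apply: contra x0 => /eqP/rnorm_eq0 ->.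
have [s1|s1] := ltP s 1; last first.
  have s2 : M - m <= (M - m) * s ^+ 2.
    by rewrite ler_peMr ?subr_ge0 ?(le_trans m_mu)// expr_ge1.
  have close l l' : m <= l <= M -> m <= l' <= M -> `|l - l'| <= (M - m) * s ^+ 2 + e.
    move=> /andP[? ?] /andP[? ?]; rewrite ler_norml; apply/andP; split; lra.
  split=> l ae.
    by exists mG => //; apply: close; [exact: rangeF|exact: rangeG].
  by exists mu => //; apply: close; [exact: rangeG|exact: rangeF].
have A_rest x : orthogonal_complement dot F x -> r (A x) x <= mu * r x x.
  set Fc := orthogonal_complement dot F => Fcx.
  have hFc : closed_subspace Fc := complement_closed Hdot hF.
  have [Fc0|Fc0] := pselect (Fc = [set 0]).
    have -> : x = 0 by move: Fcx; rewrite Fc0.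
    by rewrite -(scale0r 0) -(@of_real0 R k) !(rformZr _ _ _ hr) !mul0r mulr0.
  have AFc y : Fc y -> Fc (A y).
    move=> Fcy; apply: (complement_rdotP hF) => z Fz.
    by rewrite sA//; apply: (complement_rdot Fcy); exact: AF.
  have sAFc : symmetric_on Fc r A by move=> y z _ _; exact: sA.
  have [mc [Mc [McE _ _ _ Mc_le]]] :=
    spectrum_extrema hr (cr Fc) hFc Fc0 (operator_restrict hA AFc) sAFc.
  have := top Fc0; rewrite McE muE ler_of_real => Mc_mu.
  have /andP[_ /le_trans] := Mc_le x Fcx; apply; apply: ler_wpM2r => //.
  exact: (form_ge0 (cr Fc)).
have w0 : 0 < 2 * s ^+ 2 + 2 by rewrite ltr_wpDl// mulr_ge0// exprn_ge0.
(* The error term of top_spectra_within is e' (2 s ^ 2 + 2). *)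
have e'0 : 0 < e / (2 * s ^+ 2 + 2) by rewrite divr_gt0.
have := top_spectra_within Hdot hA sA hF hG F0 G0 AF m_mu mu_M s_ge0 s1 bnd
  _ A_rest _ _ e'0.
rewrite /= divfK ?gt_eqF//; apply.
- by move=> x Fx; have /andP[] := mu_le x Fx.
- by move=> x Fx; have := near x; rewrite (projector_id Hdot hF Fx).
- by move=> x Gx; have := near x; rewrite rnormBC (projector_id Hdot hG Gx).
Qed.

End Gap.

Theorem theorem5p3 (R : realType) (k : scalar_kind)
  (H : completeNormedModType (scalar_field R k))
  (dot : {dot H for (@conj_scalar R k)}) (Hdot : hilbert_dot dot)
  (A : {linear H -> H}) (A_bounded : bounded_near A (nbhs (0 : H)))
  (A_selfadjoint : selfadjoint dot A)
  (F G : set H)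
  (F_subspace : closed_subspace F) (F_nontrivial : F <> [set 0])
  (G_subspace : closed_subspace G) (G_nontrivial : G <> [set 0])
  (F_invariant : invariant_subspace A F)
  (F_extremal : corresponds_to_top dot A F \/ corresponds_to_bottom dot A F) :
  of_real (hausdorff_dist
             (spectrum_on F A)
             (spectrum_on G (fun x => orthogonal_projector dot G (A x))))
  <= (max_of (spectrum A) - min_of (spectrum A)) * of_real (gap dot F G) ^+ 2.
Proof.
have hr := real_form_rdot Hdot; have cr V := coercive_rdot Hdot V.
have hT := @whole_subspace R k H.
have hA : bounded_operator_on setT A.
  have /linear_boundedP[c [_ cP]] := A_bounded.
  split=> // [a x y _ _|]; first exact: linearP.
  by exists (c + 1) => x _; apply: cP; rewrite ltrDl.
have sA := selfadjoint_symmetric (V := setT) A_selfadjoint.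
have T0 : [set: H] <> [set 0].
  have [x Fx x0] := subspace_nontrivial F_subspace F_nontrivial.
  move=> T0; have /= xE : [set 0] x by rewrite -T0.
  by rewrite xE eqxx in x0.
have [m [M [ME mE _ _ bnd]]] := spectrum_extrema hr (cr setT) hT T0 hA sA.
rewrite /spectrum ME mE -of_realN -of_realD expr2 -!of_realM ler_of_real -expr2.
set ritz := fun x => orthogonal_projector dot G (A x).
set s := gap dot F G; have near x := rnorm_gap Hdot x F_subspace G_subspace.
have hAF := operator_restrict hA F_invariant.
have sAF := selfadjoint_symmetric (V := F) A_selfadjoint.
have hAG := compression_operator Hdot G_subspace hA.
have sAG := compression_symmetric Hdot G_subspace sA.
have within e : 0 < e ->
    spectra_within F A G ritz ((M - m) * s ^+ 2 + e) /\
    spectra_within G ritz F A ((M - m) * s ^+ 2 + e).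
  move=> e0; case: F_extremal => [top|bot].
    by apply: spectra_within_gap => // x; exact: bnd.
  (* F is a top subspace of - A, and the interval [m, M] becomes [- M, - m]. *)
  have hN := operatorN hT hA.
  have sN : symmetric_on setT (rdot dot) (fun x => - A x).
    by move=> x y _ _; rewrite !(rformE hr) sA.
  have NF : invariant_subspace (fun x => - A x) F.
    by move=> x Fx; apply: subspaceN => //; exact: F_invariant.
  have Nbnd x : - M * rdot dot x x <= rdot dot (- A x) x <= - m * rdot dot x x.
    by have /andP[lo hi] := bnd x I; rewrite (rformNl _ _ hr) !mulNr !lerN2 lo hi.
  have [] := spectra_within_gap Hdot hN sN F_subspace F_nontrivial G_subspace G_nontrivial
    NF bot Nbnd near e0.
  rewrite opprK [- m + M]addrC => FG GF.
  have compN : (fun x => orthogonal_projector dot G (- A x)) = (fun x => - ritz x).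
    by apply/funext => x; rewrite -scaleN1r projectorZ// scaleN1r.
  have NN V (P : H -> H) l :
      approx_eigenvalue V (fun x => - P x) l -> approx_eigenvalue V P (- l).
    move=> /approx_eigenvalueN ae g g0; have [x Vx] := ae g g0.
    by rewrite opprK; exists x.
  rewrite compN in FG GF; split=> l /approx_eigenvalueN.
    by move=> /FG[l' /NN ae' ll']; exists (- l') => //; rewrite opprK -normrN opprD.
  by move=> /GF[l' /NN ae' ll']; exists (- l') => //; rewrite opprK -normrN opprD.
have specF := spectrum_approx hr (cr F) F_subspace hAF sAF.
have specG := spectrum_approx hr (cr G) G_subspace hAG sAG.
apply/ler_addgt0Pr => e e0; have [FG GF] := within e e0.
have [mF [_ [_ _ aeF _ _]]] := spectrum_extrema hr (cr F) F_subspace F_nontrivial hAF sAF.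
have [mG [_ [_ _ aeG _ _]]] := spectrum_extrema hr (cr G) G_subspace G_nontrivial hAG sAG.
apply: hausdorff_dist_le.
- by exists (of_real mF); apply/specF; exists mF.
- by exists (of_real mG); apply/specG; exists mG.
- move=> _ /specF[l -> /FG[l' ae' ll']].
  exists (of_real l'); first by apply/specG; exists l'.
  by rewrite -of_realN -of_realD rabs_of_real.
- move=> _ /specG[l -> /GF[l' ae' ll']].
  exists (of_real l'); first by apply/specF; exists l'.
  by rewrite -of_realN -of_realD rabs_of_real.
Qed.
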